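(* Let $X$ be a Banach space, $k\in\mathbb{N}$ and $(x_s)_{s\in[\mathbb{N}]^k}$ a $k$-sequence in $X$ subordinated with respect to the weak topology, with weak limit $x_0$; put $x'_s=x_s-x_0$. Assume that for some infinite $M\subseteq\mathbb{N}$, $(x_s)_{s\in[M]^k}$ generates a non-trivial $k$-spreading model $(e_n)_n$. If $x_0\neq0$ then exactly one of the following holds: (i) $(e_n)_n$, as well as every $k$-spreading model of $(x'_s)_{s\in[M]^k}$, is equivalent to the usual basis of $\ell^1$; (ii) $(e_n)_n$ is singular, and if $e_n=e'_n+e$ is its natural decomposition then every $k$-spreading model of $(x'_s)_{s\in[M]^k}$ is isometrically equivalent to $(e'_n)_n$, and $\|e\|=\|x_0\|$.
   Context: $k$-sequences, subordinated $k$-sequences and $k$-spreading models: $[M]^k$ is the set of $k$-subsets of $M$ (increasing enumerations). Subordinated: there is continuous $\widehat\varphi:[\mathbb{N}]^{\le k}\to(X,w)$ (topology of $\{0,1\}^{\mathbb{N}}$ on sets of size $\le k$) with $\widehat\varphi(s)=x_s$ on $[\mathbb{N}]^k$; its weak limit is $\widehat\varphi(\emptyset)$. Plegma family: $(s_j)_{j=1}^l$ in $[M]^k$ with $s_1(i)<\dots<s_l(i)$ ($i\le k$) and $s_l(i)<s_1(i+1)$ ($i<k$). $(x_s)_{s\in[M]^k}$ generates $(e_n)$ (Hamel basis of a seminormed space $(E,\|\cdot\|_* )$) as a $k$-spreading model if for a null sequence $\delta_l>0$: $|\|\sum_{j=1}^m a_jx_{s_j}\|-\|\sum_{j=1}^m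 a_je_j\|_*|\le\delta_l$ whenever $m\le l$, $(s_j)_{j=1}^m$ plegma in $[M]^k$ with $s_1(1)\ge M(l)$, $a_j\in[-1,1]$. Spreading sequences: $(e_n)$ is trivial if $\|e_1-e_2\|_*=0$; a non-trivial spreading sequence is singular if it is not a Schauder basic sequence in the Banach space $E$ it generates. A singular spreading sequence converges weakly to some nonzero $e\in E$, and $e_n=e'_n+e$ with $e'_n=e_n-e$ is called its natural decomposition ($(e'_n)$ is then spreading, unconditional and weakly null). *)

(* Defs.v *)
From Stdlib Require Import Reals Lra Lia List.
Import ListNotations.
Open Scope R_scope.
Set Implicit Arguments.

Record NormedSpace := mkNS {
  V :> Type;
  vzero : V;
  vadd : V -> V -> V;
  vopp : V -> V;
  vscal : R -> V -> V;
  vnorm : V -> R;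
  vadd_assoc : forall x y z, vadd x (vadd y z) = vadd (vadd x y) z;
  vadd_comm : forall x y, vadd x y = vadd y x;
  vadd_0 : forall x, vadd x vzero = x;
  vadd_opp : forall x, vadd x (vopp x) = vzero;
  vscal_assoc : forall a b x, vscal a (vscal b x) = vscal (a * b) x;
  vscal_1 : forall x, vscal 1 x = x;
  vscal_distr_v : forall a x y, vscal a (vadd x y) = vadd (vscal a x) (vscal a y);
  vscal_distr_s : forall a b x, vscal (a + b) x = vadd (vscal a x) (vscal b x);
  vnorm_def : forall x, vnorm x = 0 -> x = vzero;
  vnorm_scal : forall a x, vnorm (vscal a x) = Rabs a * vnorm x;
  vnorm_triangle : forall x y, vnorm (vadd x y) <= vnorm x + vnorm y }.

Arguments vzero {n}.
Arguments vadd {n}.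
Arguments vopp {n}.
Arguments vscal {n}.
Arguments vnorm {n}.

Definition Banach (X : NormedSpace) : Prop :=
  forall u : nat -> X,
    (forall eps, 0 < eps -> exists n0, forall m n, (n0 <= m)%nat -> (n0 <= n)%nat ->
        vnorm (vadd (u m) (vopp (u n))) < eps) ->
    exists x : X, Un_cv (fun n => vnorm (vadd (u n) (vopp x))) 0.

Definition dual_elt {X : NormedSpace} (f : X -> R) : Prop :=
  (forall x y, f (vadd x y) = f x + f y) /\
  (forall a x, f (vscal a x) = a * f x) /\
  (exists C, forall x, Rabs (f x) <= C * vnorm x).

(** * Finite subsets of nat, as strictly increasing lists *)
Definition incr_list (s : list nat) : Prop :=
  forall i, (S i < length s)%nat -> (nth i s 0 < nth (S i) s 0)%nat.

Definition in_Nlek (k : nat) (s : list nat) : Prop :=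
  incr_list s /\ (length s <= k)%nat.

(** Infinite subsets of nat are given by their increasing enumeration M(0) < M(1) < ... *)
Definition strictly_increasing (M : nat -> nat) : Prop :=
  forall i j, (i < j)%nat -> (M i < M j)%nat.

Definition in_Mk (M : nat -> nat) (k : nat) (s : list nat) : Prop :=
  incr_list s /\ length s = k /\ (forall n, In n s -> exists i, M i = n).

Definition infinite_subset_of (L M : nat -> nat) : Prop :=
  strictly_increasing L /\ forall i, exists j, L i = M j.

(** Weak continuity of phi : [N]^{<=k} -> (X,w), where [N]^{<=k} carries the
    topology of {0,1}^N: basic neighbourhoods of s are the sets of t agreeing
    with s on {0,...,n}; the weak topology is the initial topology of X^*. *)
Definition weakly_continuous_on_Nlek {X : NormedSpace} (k : nat)
    (phi : list nat -> X) : Prop :=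
  forall f : X -> R, dual_elt f ->
  forall s, in_Nlek k s ->
  forall eps, 0 < eps ->
  exists n, forall t, in_Nlek k t ->
    (forall i, (i <= n)%nat -> (In i s <-> In i t)) ->
    Rabs (f (phi t) - f (phi s)) < eps.

Definition subordinated_weak {X : NormedSpace} (k : nat) (x : list nat -> X) (x0 : X)
  : Prop :=
  exists phi : list nat -> X,
    weakly_continuous_on_Nlek k phi /\
    (forall s, in_Mk (fun i => i) k s -> phi s = x s) /\
    phi [] = x0.

Definition plegma (k : nat) (ss : list (list nat)) : Prop :=
  (forall i j, (i < k)%nat -> (S j < length ss)%nat ->
      (nth i (nth j ss []) 0 < nth i (nth (S j) ss []) 0)%nat) /\
  (forall i, (S i < k)%nat -> (0 < length ss)%nat ->
      (nth i (nth (length ss - 1) ss []) 0 < nth (S i) (nth 0 ss []) 0)%nat).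

Fixpoint comb {X : NormedSpace} (x : list nat -> X) (ss : list (list nat)) (a : list R)
  : X :=
  match ss, a with
  | s :: ss', c :: a' => vadd (vscal c (x s)) (comb x ss' a')
  | _, _ => vzero
  end.

(** * Seminormed spaces with a Hamel basis (e_n): encoded as c00 (finitely
    supported coefficient lists [a_0; ...; a_{m-1}] standing for sum a_j e_j)
    with a seminorm N. *)
Fixpoint ladd (a b : list R) : list R :=
  match a, b with
  | [], _ => b
  | _, [] => a
  | c :: a', d :: b' => (c + d) :: ladd a' b'
  end.
Definition lscal (c : R) (a : list R) : list R := map (Rmult c) a.
Definition lsum (a : list R) : R := fold_right Rplus 0 a.
Definition l1norm (a : list R) : R := fold_right (fun c r => Rabs c + r) 0 a.
Definition unit_vec (n : nat) : list R := repeat 0 n ++ [1].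
Definition partial (a : nat -> R) (n : nat) : list R := map a (seq 0 n).

Definition is_seminorm (N : list R -> R) : Prop :=
  (forall a, N (a ++ [0]) = N a) /\
  (forall c a, N (lscal c a) = Rabs c * N a) /\
  (forall a b, N (ladd a b) <= N a + N b).

(** (x_s)_{s in [M]^k} generates (e_n) (seminorm N) as a k-spreading model.
    Index shift: the paper's l (>= 1) corresponds to S l here, M(S l) to M l. *)
Definition generates {X : NormedSpace} (k : nat) (x : list nat -> X) (M : nat -> nat)
    (N : list R -> R) : Prop :=
  exists delta : nat -> R,
    (forall l, 0 < delta l) /\ Un_cv delta 0 /\
    forall (l : nat) (ss : list (list nat)) (a : list R),
      (length ss <= S l)%nat ->
      length a = length ss ->
      plegma k ss ->
      (forall s, In s ss -> in_Mk M k s) ->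
      (ss <> [] -> (M l <= nth 0 (nth 0 ss []) 0)%nat) ->
      (forall c, In c a -> -1 <= c <= 1) ->
      Rabs (vnorm (comb x ss a) - N a) <= delta l.

Definition is_spreading_model_of {X : NormedSpace} (k : nat) (x : list nat -> X)
    (M : nat -> nat) (N : list R -> R) : Prop :=
  exists L, infinite_subset_of L M /\ is_seminorm N /\ generates k x L N.

Definition trivial_seq (N : list R -> R) : Prop := N [1; -1] = 0.

Definition equiv_l1 (N : list R -> R) : Prop :=
  exists c C, 0 < c /\ 0 < C /\ forall a, c * l1norm a <= N a <= C * l1norm a.

(** * The Banach space E generated by (e_n): the completion of (c00, N).
    Elements are represented by N-Cauchy sequences u : nat -> list R. *)
Definition ldiff (a b : list R) : list R := ladd a (lscal (-1) b).

Definition N_cauchy (N : list R -> R) (u : nat -> list R) : Prop :=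
  forall eps, 0 < eps -> exists n0, forall i j, (n0 <= i)%nat -> (n0 <= j)%nat ->
    N (ldiff (u i) (u j)) < eps.

Definition expands (N : list R -> R) (a : nat -> R) (u : nat -> list R) : Prop :=
  forall eps, 0 < eps -> exists n0, forall n, (n0 <= n)%nat ->
    exists j0, forall j, (j0 <= j)%nat -> N (ldiff (partial a n) (u j)) < eps.

(** (e_n) is a Schauder basic sequence in E (i.e. a Schauder basis of its
    closed linear span, which is all of E) *)
Definition schauder_basic (N : list R -> R) : Prop :=
  forall u, N_cauchy N u ->
    exists a : nat -> R, expands N a u /\
      forall b : nat -> R, expands N b u -> forall n, a n = b n.

Definition singular (N : list R -> R) : Prop :=
  ~ trivial_seq N /\ ~ schauder_basic N.

(** bounded linear functionals on (c00,N) = elements of E^* *)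
Definition c00_dual (N : list R -> R) (f : list R -> R) : Prop :=
  (forall a, f (a ++ [0]) = f a) /\
  (forall a b, f (ladd a b) = f a + f b) /\
  (forall c a, f (lscal c a) = c * f a) /\
  (exists C, forall a, Rabs (f a) <= C * N a).

Definition weak_limit_in_E (N : list R -> R) (u : nat -> list R) : Prop :=
  N_cauchy N u /\
  forall f, c00_dual N f ->
    forall eps, 0 < eps -> exists n0, forall n, (n0 <= n)%nat ->
      exists j0, forall j, (j0 <= j)%nat -> Rabs (f (unit_vec n) - f (u j)) < eps.

(** ||sum_i a_i e'_i|| = ||sum_i a_i e_i - (sum_i a_i) e||, with e'_n = e_n - e *)
Definition norm_eprime (N : list R -> R) (u : nat -> list R) (a : list R) (r : R) : Prop :=
  Un_cv (fun j => N (ldiff a (lscal (lsum a) (u j)))) r.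

Definition alternative_i {X : NormedSpace} (k : nat) (x' : list nat -> X)
    (M : nat -> nat) (N : list R -> R) : Prop :=
  equiv_l1 N /\
  forall N', is_spreading_model_of k x' M N' -> equiv_l1 N'.

Definition alternative_ii {X : NormedSpace} (k : nat) (x' : list nat -> X)
    (M : nat -> nat) (N : list R -> R) (x0 : X) : Prop :=
  singular N /\
  forall u : nat -> list R, weak_limit_in_E N u ->
    (forall N', is_spreading_model_of k x' M N' ->
       forall a, norm_eprime N u a (N' a)) /\
    Un_cv (fun j => N (u j)) (vnorm x0).

(* Main.v *)
Require Import Defs.
From Stdlib Require Import Reals Lra Lia List.
From Stdlib Require Import Classical ClassicalEpsilon FunctionalExtensionality ProofIrrelevance.
From mathcomp.classical Require boolp classical_sets.
Import ListNotations.
Open Scope R_scope.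
Set Implicit Arguments.

(** By Mazur's theorem and the weak continuity of [phi] along [t, t ++ [n]], the
    limit [x0] is a norm limit of convex combinations of vectors [x s], and finitely
    many such combinations can be interlaced so that choosing one index in each
    always gives a plegma family.  Averaging some members of a combination
    [sum a_j x_{s_j}] hence replaces them by [x0] without increasing its norm beyond
    [N a].  With [osc b := N (b ++ -b)] this yields [|sum a| |x0| <= N a],
    [osc b <= 2 N a] when [b] is obtained from [a] by deleting coordinates, and
    [|sum b_j x_{s_j} - (sum b) x0| <= osc b] up to small errors.

    If [N] is equivalent to [l1], so is every [N'], because [N] and [N'] agree on
    vectors of sum zero.  Otherwise the positive or negative part of a vector with
    small [N a / |a|_1] gives [b] with [sum b = 1] and [osc b] arbitrarily small.
    Such [b] converge to a shift-invariant nonzero [e], so there is no Schauder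
    expansion of [e]; Hahn-Banach identifies [e] with the weak limit of [e_n], and
    [sum b_j x_{s_j}] being close to [x0] gives the two norm identities. *)

(** * Linear combinations in a normed space *)

(** The seminorm [N] comes without spreading invariance and without its completion. Invariance under
    inserted zeros is derived by comparing a plegma family with the same family minus one member,
    and elements of the completion enter only as Cauchy sequences. An inequality about [N] is proved
    by realising it in [X] on a single plegma family on which finitely many estimates hold at once;
    this is why the interlaced combinations must tolerate every choice of indices. The factor 2 in
    [osc b <= 2 N a] arises from two copies of [a] placed one after the other: in both, the deleted
    coordinates average to the same multiple of [x0], which cancels in the difference and leaves
    [b ++ -b]. Deletion is needed because the coordinates of [a] may sum to zero; one of its sign
    parts has a sum of absolute value at least half of [|a|_1], so dividing by that sum keeps [osc]
    small. *)

Lemma Rabs_le_inv r b : Rabs r <= b -> - b <= r <= b.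
Proof. unfold Rabs. destruct (Rcase_abs r); lra. Qed.

Inductive vexp :=
| VVar (n : nat)
| VZero
| VAdd (a b : vexp)
| VOpp (a : vexp)
| VScal (c : R) (a : vexp).

Fixpoint vcoef (e : vexp) (n : nat) : R :=
  match e with
  | VVar m => if Nat.eqb m n then 1 else 0
  | VZero => 0
  | VAdd a b => vcoef a n + vcoef b n
  | VOpp a => - vcoef a n
  | VScal c a => c * vcoef a n
  end.

Fixpoint veval {X : NormedSpace} (env : list X) (e : vexp) : X :=
  match e with
  | VVar m => nth m env vzero
  | VZero => vzero
  | VAdd a b => vadd (veval env a) (veval env b)
  | VOpp a => vopp (veval env a)
  | VScal c a => vscal c (veval env a)
  end.

Fixpoint vlin {X : NormedSpace} (env : list X) (c : nat -> R) : X :=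
  match env with
  | [] => vzero
  | v :: env' => vadd (vscal (c 0%nat) v) (vlin env' (fun n => c (S n)))
  end.

(** Recursive in [m], so that for a concrete environment [cbn] unfolds it into finitely many
    equations between reals, one [ring] goal each. *)
Fixpoint agree (m : nat) (c d : nat -> R) : Prop :=
  match m with
  | O => True
  | S m' => c 0%nat = d 0%nat /\ agree m' (fun n => c (S n)) (fun n => d (S n))
  end.

Section VectorIdentities.
Context {X : NormedSpace}.
Implicit Types x y z : X.

Lemma vadd_0_l x : vadd vzero x = x.
Proof. rewrite vadd_comm; apply vadd_0. Qed.

Lemma vadd_cancel x y z : vadd x y = vadd x z -> y = z.
Proof.
  intro H.
  rewrite <- (vadd_0_l y), <- (vadd_0_l z), <- (vadd_opp X x), (vadd_comm X x (vopp x)).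
  rewrite <- !vadd_assoc, H. reflexivity.
Qed.

Lemma vscal_0 x : vscal 0 x = vzero.
Proof.
  apply (@vadd_cancel (vscal 0 x)).
  rewrite <- vscal_distr_s, vadd_0, Rplus_0_l. reflexivity.
Qed.

Lemma vscal_zero c : vscal c (vzero : X) = vzero.
Proof. rewrite <- (vscal_0 vzero), vscal_assoc, Rmult_0_r. reflexivity. Qed.

Lemma vopp_scal x : vopp x = vscal (-1) x.
Proof.
  apply (@vadd_cancel x). rewrite vadd_opp.
  transitivity (vadd (vscal 1 x) (vscal (-1) x)); [|rewrite vscal_1; reflexivity].
  rewrite <- vscal_distr_s. replace (1 + -1) with 0 by ring. rewrite vscal_0. reflexivity.
Qed.

Lemma vadd_swap x y z w : vadd (vadd x y) (vadd z w) = vadd (vadd x z) (vadd y w).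
Proof.
  rewrite <- !vadd_assoc. f_equal. rewrite !vadd_assoc. f_equal. apply vadd_comm.
Qed.

Lemma vlin_zero (env : list X) c : (forall n, c n = 0) -> vlin env c = vzero.
Proof.
  revert c; induction env as [|v env IH]; intros c Hc; simpl; [reflexivity|].
  rewrite Hc, vscal_0, vadd_0_l. apply IH. intros; apply Hc.
Qed.

Lemma vlin_add (env : list X) c d :
  vlin env (fun n => c n + d n) = vadd (vlin env c) (vlin env d).
Proof.
  revert c d; induction env as [|v env IH]; intros c d; simpl.
  - symmetry; apply vadd_0.
  - rewrite IH with (c := fun n => c (S n)) (d := fun n => d (S n)).
    rewrite vscal_distr_s. apply vadd_swap.
Qed.

Lemma vlin_scal (env : list X) r c :
  vlin env (fun n => r * c n) = vscal r (vlin env c).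
Proof.
  revert c; induction env as [|v env IH]; intros c; simpl.
  - symmetry; apply vscal_zero.
  - rewrite IH with (c := fun n => c (S n)), vscal_distr_v, vscal_assoc. reflexivity.
Qed.

Lemma vlin_agree (env : list X) c d : agree (length env) c d -> vlin env c = vlin env d.
Proof.
  revert c d; induction env as [|v env IH]; intros c d H; simpl in *; [reflexivity|].
  destruct H as [H0 H]. rewrite H0, (IH _ _ H). reflexivity.
Qed.

Lemma vlin_var (env : list X) m :
  vlin env (fun n => if Nat.eqb m n then 1 else 0) = nth m env vzero.
Proof.
  revert m; induction env as [|v env IH]; intros [|m]; simpl; try reflexivity.
  - rewrite vscal_1, vlin_zero by (intros; reflexivity). apply vadd_0.
  - rewrite vscal_0, vadd_0_l. apply IH.
Qed.

Lemma veval_vlin (env : list X) e : veval env e = vlin env (vcoef e).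
Proof.
  induction e as [m| |a IHa b IHb|a IHa|c a IHa]; simpl.
  - symmetry; apply vlin_var.
  - symmetry; apply vlin_zero; reflexivity.
  - rewrite IHa, IHb. symmetry. apply vlin_add.
  - rewrite IHa, vopp_scal, <- vlin_scal. f_equal.
    apply functional_extensionality; intro; ring.
  - rewrite IHa. symmetry; apply vlin_scal.
Qed.

Lemma veval_eq (env : list X) e1 e2 :
  agree (length env) (vcoef e1) (vcoef e2) -> veval env e1 = veval env e2.
Proof. intro H. rewrite !veval_vlin. apply vlin_agree, H. Qed.

End VectorIdentities.

Ltac vec_mem a l :=
  lazymatch l with
  | nil => constr:(false)
  | a :: _ => constr:(true)
  | _ :: ?l' => vec_mem a l'
  end.
Ltac vec_atoms t l :=
  lazymatch t with
  | vzero => l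
  | vadd ?a ?b => let l1 := vec_atoms a l in vec_atoms b l1
  | vopp ?a => vec_atoms a l
  | vscal _ ?a => vec_atoms a l
  | _ => lazymatch vec_mem t l with true => l | false => constr:(t :: l) end
  end.
Ltac vec_index a l :=
  lazymatch l with
  | a :: _ => constr:(0%nat)
  | _ :: ?l' => let n := vec_index a l' in constr:(S n)
  end.
Ltac vec_reify t l :=
  lazymatch t with
  | vzero => constr:(VZero)
  | vadd ?a ?b => let e1 := vec_reify a l in let e2 := vec_reify b l in constr:(VAdd e1 e2)
  | vopp ?a => let e := vec_reify a l in constr:(VOpp e)
  | vscal ?c ?a => let e := vec_reify a l in constr:(VScal c e)
  | _ => let n := vec_index t l in constr:(VVar n)
  end.
(* Decides identities between linear combinations by comparing coefficients with [ring]. *)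
Ltac vec :=
  lazymatch goal with
  | |- @eq ?T ?a ?b =>
      let l0 := constr:(@nil T) in
      let l1 := vec_atoms a l0 in
      let l := vec_atoms b l1 in
      let e1 := vec_reify a l in
      let e2 := vec_reify b l in
      apply (@veval_eq _ l e1 e2); cbn; repeat split; ring
  end.

Section NormFacts.
Context {X : NormedSpace}.
Implicit Types x y z : X.

Lemma vnorm_zero : vnorm (vzero : X) = 0.
Proof. rewrite <- (vscal_0 vzero), vnorm_scal, Rabs_R0. ring. Qed.

Lemma vnorm_opp x : vnorm (vopp x) = vnorm x.
Proof. rewrite vopp_scal, vnorm_scal, Rabs_left by lra. ring. Qed.

Lemma vnorm_nonneg x : 0 <= vnorm x.
Proof.
  pose proof (vnorm_triangle X x (vopp x)) as H.
  rewrite vadd_opp, vnorm_zero, vnorm_opp in H. lra.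
Qed.

Lemma vnorm_pos x : x <> vzero -> 0 < vnorm x.
Proof.
  intro H. destruct (vnorm_nonneg x) as [H1|H1]; [exact H1|].
  exfalso. apply H, vnorm_def. auto.
Qed.

Lemma vnorm_sub_comm x y : vnorm (vadd x (vopp y)) = vnorm (vadd y (vopp x)).
Proof. rewrite <- vnorm_opp. f_equal. vec. Qed.

Lemma vnorm_le_add x y : vnorm x <= vnorm y + vnorm (vadd x (vopp y)).
Proof.
  replace x with (vadd y (vadd x (vopp y))) at 1 by vec. apply vnorm_triangle.
Qed.

Lemma vnorm_abs_sub x y : Rabs (vnorm x - vnorm y) <= vnorm (vadd x (vopp y)).
Proof.
  pose proof (vnorm_le_add x y). pose proof (vnorm_le_add y x) as H1.
  rewrite vnorm_sub_comm in H1. apply Rabs_le. lra.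
Qed.

End NormFacts.

(** * Hahn-Banach for sublinear functionals *)

Definition is_inf (E : R -> Prop) (m : R) : Prop :=
  (forall r, E r -> m <= r) /\ (forall b, (forall r, E r -> b <= r) -> b <= m).

(** A total infimum, so that functionals can be defined pointwise first and shown to be finite
    afterwards. *)
Definition rinf (E : R -> Prop) : R := epsilon (inhabits 0) (is_inf E).

Lemma rinf_spec (E : R -> Prop) :
  (exists r, E r) -> (exists b, forall r, E r -> b <= r) -> is_inf E (rinf E).
Proof.
  intros [r0 Hr0] [b Hb]. unfold rinf. apply epsilon_spec.
  destruct (completeness (fun r => E (- r))) as [m [Hm1 Hm2]].
  - exists (- b). intros r Hr. specialize (Hb _ Hr). lra.
  - exists (- r0). rewrite Ropp_involutive. exact Hr0.
  - exists (- m). split.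
    + intros r Hr. enough (- r <= m) by lra. apply Hm1.
      rewrite Ropp_involutive. exact Hr.
    + intros c Hc. enough (m <= - c) by lra. apply Hm2. intros r Hr.
      specialize (Hc _ Hr). lra.
Qed.

(* A real vector space in which [0 x] need not be neutral: coefficient lists,
   where [0 x] is a list of zeros, are an instance just like a normed space. *)
Record PreModule := mkPM {
  pm :> Type;
  padd : pm -> pm -> pm;
  pscal : R -> pm -> pm;
  padd_assoc : forall x y z, padd x (padd y z) = padd (padd x y) z;
  padd_comm : forall x y, padd x y = padd y x;
  pscal_assoc : forall a b x, pscal a (pscal b x) = pscal (a * b) x;
  pscal_1 : forall x, pscal 1 x = x;
  pscal_distr_v : forall a x y, pscal a (padd x y) = padd (pscal a x) (pscal a y);
  pscal_distr_s : forall a b x, pscal (a + b) x = padd (pscal a x) (pscal b x) }.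

Arguments padd {p}.
Arguments pscal {p}.

Section HahnBanach.
Context {T : PreModule}.
Implicit Types x y z : T.

(** In a [PreModule] the vector [0 z] need not be neutral. The field [sub_null] makes [q] blind to
    it, which restores the cancellation of [z] in [z + x - z] under [q]. *)
Record sublinear (q : T -> R) : Prop := {
  sub_add : forall x y, q (padd x y) <= q x + q y;
  sub_scal : forall t x, 0 <= t -> q (pscal t x) = t * q x;
  sub_null : forall x z, q (padd x (pscal 0 z)) = q x }.

Lemma padd_swap x y z w : padd (padd x y) (padd z w) = padd (padd x z) (padd y w).
Proof.
  rewrite <- !padd_assoc. f_equal. rewrite !padd_assoc. f_equal. apply padd_comm.
Qed.

Lemma padd_opp_cancel x z : padd (padd z x) (pscal (-1) z) = padd x (pscal 0 z).
Proof.
  rewrite (padd_comm _ z x), <- padd_assoc. f_equal.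
  rewrite <- (pscal_1 _ z) at 1. rewrite <- pscal_distr_s. f_equal. ring.
Qed.

Lemma sublinear_lower q x y : sublinear q -> q y - q (pscal (-1) x) <= q (padd x y).
Proof.
  intro Hq. pose proof (sub_add Hq (padd x y) (pscal (-1) x)) as H.
  rewrite padd_opp_cancel, (sub_null Hq) in H. lra.
Qed.

Lemma sublinear_opp q x : sublinear q -> - q (pscal (-1) x) <= q x.
Proof.
  intro Hq. pose proof (sublinear_lower x (pscal 0 x) Hq) as H.
  rewrite (sub_null Hq), (sub_scal Hq) in H by lra. lra.
Qed.

Lemma sublinear_odd_linear q : sublinear q ->
  (forall y, q (pscal (-1) y) <= - q y) ->
  (forall x y, q (padd x y) = q x + q y) /\ (forall c x, q (pscal c x) = c * q x).
Proof.
  intros Hq Hodd.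
  assert (Heq : forall y, q (pscal (-1) y) = - q y).
  { intro y. pose proof (sublinear_opp y Hq). specialize (Hodd y). lra. }
  split.
  - intros x y. pose proof (sublinear_lower x y Hq) as H. rewrite Heq in H.
    pose proof (sub_add Hq x y). lra.
  - intros c x. destruct (Rle_lt_dec 0 c) as [Hc|Hc].
    + apply (sub_scal Hq), Hc.
    + replace c with (-1 * - c) at 1 by ring.
      rewrite <- pscal_assoc, Heq, (sub_scal Hq) by lra. ring.
Qed.

(** A pair [K v t] is read as a demand [t <= f v] on a linear functional still to be found; demands
    may be added and dilated. *)
Definition cone (K : T -> R -> Prop) : Prop :=
  (exists v, K (pscal 0 v) 0) /\
  (forall v t w s, K v t -> K w s -> K (padd v w) (t + s)) /\
  (forall c v t, 0 < c -> K v t -> K (pscal c v) (c * t)).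

(** The functional [q] lowered as far as the demands require: at [-v] its value is at most [-t], so
    every linear functional below it satisfies [t <= f v]. *)
Definition cone_inf (q : T -> R) (K : T -> R -> Prop) (z : T) : R :=
  rinf (fun r => exists v t, K v t /\ r = q (padd z v) - t).

Lemma cone_inf_spec q K z : sublinear q -> cone K -> (forall v t, K v t -> t <= q v) ->
  is_inf (fun r => exists v t, K v t /\ r = q (padd z v) - t) (cone_inf q K z).
Proof.
  intros Hq [[v0 HK0] _] Hle. apply rinf_spec.
  - eexists. exists (pscal 0 v0), 0. split; [exact HK0|reflexivity].
  - exists (- q (pscal (-1) z)). intros r (v & t & HK & ->).
    pose proof (sublinear_lower z v Hq). specialize (Hle _ _ HK). lra.
Qed.

Lemma cone_inf_le q K z v t : sublinear q -> cone K -> (forall v t, K v t -> t <= q v) ->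
  K v t -> cone_inf q K z <= q (padd z v) - t.
Proof.
  intros Hq HK Hle HKv. apply (cone_inf_spec z Hq HK Hle). eauto.
Qed.

Lemma cone_inf_le_self q K z : sublinear q -> cone K -> (forall v t, K v t -> t <= q v) ->
  cone_inf q K z <= q z.
Proof.
  intros Hq HK Hle. destruct (HK) as [[v0 HK0] _].
  pose proof (@cone_inf_le q K z _ _ Hq HK Hle HK0) as H. rewrite (sub_null Hq) in H. lra.
Qed.

(** Dilating a demand by [c] matches the candidates for [z] with those for [c z]. The reverse
    inequality is the same statement for [/ c]. *)
Lemma cone_inf_scal_le q K z c : sublinear q -> cone K -> (forall v t, K v t -> t <= q v) ->
  0 < c -> cone_inf q K (pscal c z) <= c * cone_inf q K z.
Proof.
  intros Hq HK Hle Hc.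
  enough (/ c * cone_inf q K (pscal c z) <= cone_inf q K z) as H.
  { apply (Rmult_le_compat_l c) in H; [|lra].
    rewrite <- Rmult_assoc, Rinv_r, Rmult_1_l in H by lra. exact H. }
  apply (cone_inf_spec z Hq HK Hle). intros r (v & t & HKv & ->).
  assert (HKc : K (pscal c v) (c * t)) by (apply HK; assumption).
  pose proof (@cone_inf_le q K (pscal c z) _ _ Hq HK Hle HKc) as H.
  rewrite <- pscal_distr_v, (sub_scal Hq) in H by lra.
  apply (Rmult_le_compat_l (/ c)) in H; [|left; apply Rinv_0_lt_compat, Hc].
  replace (/ c * (c * q (padd z v) - c * t)) with (q (padd z v) - t) in H by (field; lra).
  exact H.
Qed.

Lemma cone_inf_sublinear q K : sublinear q -> cone K -> (forall v t, K v t -> t <= q v) ->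
  sublinear (cone_inf q K).
Proof.
  intros Hq HK Hle. split.
  - intros x y.
    enough (cone_inf q K (padd x y) - cone_inf q K y <= cone_inf q K x) by lra.
    apply (cone_inf_spec x Hq HK Hle). intros r (v & t & HKv & ->).
    enough (cone_inf q K (padd x y) - (q (padd x v) - t) <= cone_inf q K y) by lra.
    apply (cone_inf_spec y Hq HK Hle). intros r (w & s & HKw & ->).
    assert (HKvw : K (padd v w) (t + s)) by (apply HK; assumption).
    pose proof (@cone_inf_le q K (padd x y) _ _ Hq HK Hle HKvw) as H.
    rewrite padd_swap in H. pose proof (sub_add Hq (padd x v) (padd y w)). lra.
  - intros c x [Hc| <-].
    + apply Rle_antisym; [apply cone_inf_scal_le; assumption|].
      pose proof (@cone_inf_scal_le q K (pscal c x) (/ c) Hq HK Hle (Rinv_0_lt_compat _ Hc)) as H.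
      rewrite pscal_assoc, Rinv_l, pscal_1 in H by lra.
      apply (Rmult_le_compat_l c) in H; [|lra].
      rewrite <- Rmult_assoc, Rinv_r, Rmult_1_l in H by lra. exact H.
    + rewrite Rmult_0_l. apply Rle_antisym.
      * pose proof (cone_inf_le_self (pscal 0 x) Hq HK Hle) as H.
        rewrite (sub_scal Hq) in H by lra. lra.
      * apply (cone_inf_spec _ Hq HK Hle). intros r (v & t & HKv & ->).
        rewrite padd_comm, (sub_null Hq). specialize (Hle _ _ HKv). lra.
  - intros x z. unfold cone_inf. f_equal. apply functional_extensionality. intro r.
    assert (H : forall v, q (padd (padd x (pscal 0 z)) v) = q (padd x v)).
    { intro v. rewrite <- padd_assoc, (padd_comm _ _ v), padd_assoc. apply (sub_null Hq). }
    apply boolp.propositional_extensionality.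
    split; intros (v & t & HKv & ->); exists v, t; rewrite H; auto.
Qed.

(** Comparability yields subadditivity: the smaller of [q1] and [q2] is at most [q1 x + q2 y] at
    [x + y]. The common majorant [p] bounds all members below by [- p (-x)], so the infimum is
    finite. *)
Lemma chain_inf_sublinear (p : T -> R) (A : (T -> R) -> Prop) :
  (exists q, A q) -> (forall q, A q -> sublinear q /\ forall x, q x <= p x) ->
  (forall q1 q2, A q1 -> A q2 -> (forall x, q1 x <= q2 x) \/ (forall x, q2 x <= q1 x)) ->
  exists q, sublinear q /\ forall q1, A q1 -> forall x, q x <= q1 x.
Proof.
  intros [q0 Hq0] HA Hchain.
  pose (E := fun x r => exists q, A q /\ r = q x).
  assert (HE : forall x, is_inf (E x) (rinf (E x))).
  { intro x. apply rinf_spec; [exists (q0 x), q0; auto|].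
    exists (- p (pscal (-1) x)). intros r (q & Hq & ->).
    destruct (HA _ Hq) as [Hs Hp]. pose proof (sublinear_opp x Hs).
    specialize (Hp (pscal (-1) x)). lra. }
  assert (Hlow : forall q, A q -> forall x, rinf (E x) <= q x).
  { intros q Hq x. apply HE. exists q. auto. }
  exists (fun x => rinf (E x)). split; [|exact Hlow]. split.
  - intros x y.
    enough (rinf (E (padd x y)) - rinf (E y) <= rinf (E x)) by lra.
    apply HE. intros r (q1 & H1 & ->).
    enough (rinf (E (padd x y)) - q1 x <= rinf (E y)) by lra.
    apply HE. intros r (q2 & H2 & ->).
    destruct (Hchain _ _ H1 H2) as [H|H].
    + pose proof (Hlow _ H1 (padd x y)).
      pose proof (sub_add (proj1 (HA _ H1)) x y). specialize (H y). lra.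
    + pose proof (Hlow _ H2 (padd x y)).
      pose proof (sub_add (proj1 (HA _ H2)) x y). specialize (H x). lra.
  - intros t x Ht.
    assert (Hge : t * rinf (E x) <= rinf (E (pscal t x))).
    { apply HE. intros r (q & Hq & ->). rewrite (sub_scal (proj1 (HA _ Hq))) by exact Ht.
      apply Rmult_le_compat_l; [exact Ht|]. apply Hlow, Hq. }
    apply Rle_antisym; [|exact Hge]. destruct Ht as [Ht| <-].
    + enough (/ t * rinf (E (pscal t x)) <= rinf (E x)) as H.
      { apply (Rmult_le_compat_l t) in H; [|lra].
        rewrite <- Rmult_assoc, Rinv_r, Rmult_1_l in H by lra. exact H. }
      apply HE. intros r (q & Hq & ->). pose proof (Hlow _ Hq (pscal t x)) as H.
      rewrite (sub_scal (proj1 (HA _ Hq))) in H by lra.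
      apply (Rmult_le_compat_l (/ t)) in H; [|left; apply Rinv_0_lt_compat, Ht].
      rewrite <- (Rmult_assoc _ t), Rinv_l, Rmult_1_l in H by lra. exact H.
    + pose proof (Hlow _ Hq0 (pscal 0 x)) as H.
      rewrite (sub_scal (proj1 (HA _ Hq0))) in H by lra. lra.
  - intros x z. f_equal. apply functional_extensionality. intro r.
    apply boolp.propositional_extensionality.
    split; intros (q & Hq & ->); exists q; rewrite (sub_null (proj1 (HA _ Hq))); auto.
Qed.

(* A minimal sublinear functional below [p] is linear, because lowering it along
   a single ray [{t y}] cannot decrease it. *)
Theorem hahn_banach (p : T -> R) : sublinear p ->
  exists f : T -> R, (forall x y, f (padd x y) = f x + f y) /\
    (forall c x, f (pscal c x) = c * f x) /\ (forall x, f x <= p x).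
Proof.
  intro Hp.
  pose (S := {q : T -> R | sublinear q /\ forall x, q x <= p x}).
  pose (below := fun s t : S => forall x, proj1_sig t x <= proj1_sig s x).
  (* The pointwise order is reversed, so a maximal element is a minimal functional; [asbool] turns
     the order into a boolean relation. *)
  destruct (@classical_sets.Zorn S (fun s t => boolp.asbool (below s t))) as [[q [Hq Hqp]] Hmin].
  - intro t. apply boolp.asboolT. intro x. lra.
  - intros r s t H1 H2. apply boolp.asboolW in H1. apply boolp.asboolW in H2.
    apply boolp.asboolT. intro x. specialize (H1 x). specialize (H2 x). lra.
  - intros [r Hr] [s Hs] H1 H2. apply boolp.asboolW in H1. apply boolp.asboolW in H2.
    apply subset_eq_compat. apply functional_extensionality. intro x.
    specialize (H1 x). specialize (H2 x). cbn in H1, H2. lra.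
  - intros A HA. destruct (classic (exists s, A s)) as [[s0 Hs0]|Hne].
    + pose (B := fun q => exists s, A s /\ proj1_sig s = q).
      destruct (@chain_inf_sublinear p B) as (q & Hq & Hlow).
      * exists (proj1_sig s0), s0. auto.
      * intros q (s & _ & <-). apply (proj2_sig s).
      * intros q1 q2 (s1 & H1 & <-) (s2 & H2 & <-).
        destruct (HA s1 s2 H1 H2) as [H|H]; apply boolp.asboolW in H; auto.
      * assert (Hqp : forall x, q x <= p x).
        { intro x. apply Rle_trans with (proj1_sig s0 x).
          - apply Hlow. exists s0. auto.
          - apply (proj2_sig s0). }
        exists (exist _ q (conj Hq Hqp)). intros s Hs. apply boolp.asboolT. intro x.
        cbn. apply Hlow. exists s. auto.
    + exists (exist _ p (conj Hp (fun x => Rle_refl _))). intros s Hs.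
      exfalso. apply Hne. exists s. exact Hs.
  - assert (Hodd : forall y, q (pscal (-1) y) <= - q y).
    { intro y.
      (* The ray demands the value [q y] at [y]. The lowered functional is then at most [- q y] at
         [-y], and by minimality it equals [q]. *)
      pose (K := fun (v : T) (r : R) => exists t, 0 <= t /\ v = pscal t y /\ r = t * q y).
      assert (HK : cone K).
      { split; [|split].
        - exists y, 0. repeat split; lra.
        - intros v t w s (t1 & H1 & -> & ->) (t2 & H2 & -> & ->). exists (t1 + t2).
          split; [lra|split; [|ring]]. symmetry. apply pscal_distr_s.
        - intros c v t Hc (t1 & H1 & -> & ->). exists (c * t1).
          split; [apply Rmult_le_pos; lra|split; [apply pscal_assoc|ring]]. }
      assert (Hle : forall v t, K v t -> t <= q v).
      { intros v t (t1 & H1 & -> & ->). rewrite (sub_scal Hq) by exact H1. lra. }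
      assert (Hself := fun z => cone_inf_le_self z Hq HK Hle).
      assert (Hs : sublinear (cone_inf q K) /\ forall x, cone_inf q K x <= p x).
      { split; [apply cone_inf_sublinear; assumption|]. intro x.
        pose proof (Hself x). pose proof (Hqp x). lra. }
      assert (Heq : cone_inf q K = q).
      { specialize (Hmin (exist _ _ Hs)). apply (f_equal (@proj1_sig _ _)) in Hmin; [exact Hmin|].
        apply boolp.asboolT. exact Hself. }
      pose proof (f_equal (fun g => g (pscal (-1) y)) Heq) as Hy. cbv beta in Hy.
      assert (HKy : K y (q y)).
      { exists 1. split; [lra|split; [symmetry; apply pscal_1|ring]]. }
      pose proof (@cone_inf_le q K (pscal (-1) y) _ _ Hq HK Hle HKy) as H.
      assert (Hz : q (padd (pscal (-1) y) y) = 0).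
      { rewrite <- (pscal_1 _ y) at 2. rewrite <- pscal_distr_s.
        replace (-1 + 1) with 0 by ring. rewrite (sub_scal Hq) by lra. ring. }
      lra. }
    destruct (sublinear_odd_linear Hq Hodd) as [Hadd Hscal].
    exists q. auto.
Qed.

(** Take a linear functional below [cone_inf p K]: the null demand places it below [p], and
    evaluation at [-v] shows that it meets the demand on [v]. *)
Lemma cone_separation (p : T -> R) (K : T -> R -> Prop) : sublinear p -> cone K ->
  (forall v t, K v t -> t <= p v) ->
  exists f : T -> R, (forall x y, f (padd x y) = f x + f y) /\
    (forall c x, f (pscal c x) = c * f x) /\ (forall x, f x <= p x) /\
    (forall v t, K v t -> t <= f v).
Proof.
  intros Hp HK Hle.
  destruct (hahn_banach (cone_inf_sublinear Hp HK Hle)) as (f & Hadd & Hscal & Hf).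
  exists f. split; [exact Hadd|]. split; [exact Hscal|]. split.
  - intro x. apply Rle_trans with (1 := Hf x). apply cone_inf_le_self; assumption.
  - intros v t HKv. specialize (Hf (pscal (-1) v)). rewrite Hscal in Hf.
    pose proof (@cone_inf_le p K (pscal (-1) v) _ _ Hp HK Hle HKv) as H.
    assert (Hz : p (padd (pscal (-1) v) v) = 0).
    { rewrite <- (pscal_1 _ v) at 2. rewrite <- pscal_distr_s.
      replace (-1 + 1) with 0 by ring. rewrite (sub_scal Hp) by lra. ring. }
    lra.
Qed.

End HahnBanach.

(** * Convex combinations and plegma grids *)

Definition normed_premodule (X : NormedSpace) : PreModule :=
  mkPM (@vadd X) (@vscal X) (vadd_assoc X) (vadd_comm X) (vscal_assoc X) (vscal_1 X)
    (vscal_distr_v X) (vscal_distr_s X).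

Section WeightedSums.
Context {A : Type}.

Definition wsum (W : list (R * A)) : R := fold_right (fun p r => fst p + r) 0 W.

Definition nonneg_weights (W : list (R * A)) : Prop := Forall (fun p => 0 <= fst p) W.

Definition wavg {X : NormedSpace} (y : A -> X) (W : list (R * A)) : X :=
  fold_right (fun p v => vadd (vscal (fst p) (y (snd p))) v) vzero W.

Definition wscale (c : R) (W : list (R * A)) : list (R * A) :=
  map (fun p => (c * fst p, snd p)) W.

Lemma wsum_cons p W : wsum (p :: W) = fst p + wsum W.
Proof. reflexivity. Qed.

Lemma wsum_app W1 W2 : wsum (W1 ++ W2) = wsum W1 + wsum W2.
Proof. induction W1 as [|p W1 IH]; simpl; [ring|rewrite IH; ring]. Qed.

Lemma wsum_wscale c W : wsum (wscale c W) = c * wsum W.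
Proof. induction W as [|p W IH]; simpl; [ring|rewrite IH; ring]. Qed.

Lemma wsum_nonneg W : nonneg_weights W -> 0 <= wsum W.
Proof. induction 1; simpl; lra. Qed.

Lemma wscale_nonneg c W : 0 <= c -> nonneg_weights W -> nonneg_weights (wscale c W).
Proof.
  intros Hc H. unfold nonneg_weights, wscale. rewrite Forall_map.
  apply Forall_impl with (2 := H). intros p Hp. simpl. apply Rmult_le_pos; assumption.
Qed.

Lemma snd_wscale c W p : In p (wscale c W) -> exists q, In q W /\ snd q = snd p.
Proof.
  unfold wscale. rewrite in_map_iff. intros (q & <- & Hq). exists q. auto.
Qed.

Context {X : NormedSpace}.
Implicit Type y : A -> X.

Lemma wavg_cons y p W : wavg y (p :: W) = vadd (vscal (fst p) (y (snd p))) (wavg y W).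
Proof. reflexivity. Qed.

Lemma wavg_app y W1 W2 : wavg y (W1 ++ W2) = vadd (wavg y W1) (wavg y W2).
Proof.
  induction W1 as [|p W1 IH]; simpl.
  - symmetry. apply vadd_0_l.
  - rewrite IH. vec.
Qed.

Lemma wavg_wscale y c W : wavg y (wscale c W) = vscal c (wavg y W).
Proof.
  induction W as [|p W IH]; simpl.
  - symmetry. apply vscal_zero.
  - rewrite IH. vec.
Qed.

(** Convexity of the norm in one averaged position. The fixed part [z] carries the factor [wsum W]
    so that the induction runs through lists of arbitrary total weight. *)
Lemma vnorm_wavg_le y W (z : X) c D : nonneg_weights W ->
  (forall p, In p W -> vnorm (vadd z (vscal c (y (snd p)))) <= D) ->
  vnorm (vadd (vscal (wsum W) z) (vscal c (wavg y W))) <= wsum W * D.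
Proof.
  induction 1 as [|p W Hp HW IH]; intro HD; simpl.
  - rewrite vscal_0, vscal_zero, vadd_0, vnorm_zero. lra.
  - replace (vadd _ _) with (vadd (vscal (fst p) (vadd z (vscal c (y (snd p)))))
       (vadd (vscal (wsum W) z) (vscal c (wavg y W)))) by vec.
    eapply Rle_trans; [apply vnorm_triangle|].
    rewrite vnorm_scal, Rabs_pos_eq, Rmult_plus_distr_r by exact Hp.
    apply Rplus_le_compat.
    + apply Rmult_le_compat_l; [exact Hp|]. apply HD. left. reflexivity.
    + apply IH. intros q Hq. apply HD. right. exact Hq.
Qed.

(** If every convex combination stays at distance at least [eps] from [z], the cone spanned by the
    differences [y a - z], with demand [eps] times the total weight, lies below the norm. A
    separating functional then keeps [f (y a)] at least [eps] above [f z], against weak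
    approximability. *)
Theorem mazur y (P : A -> Prop) (z : X) (eps : R) : 0 < eps ->
  (forall f, dual_elt f -> forall e, 0 < e -> exists a, P a /\ Rabs (f (y a) - f z) < e) ->
  exists W, nonneg_weights W /\ wsum W = 1 /\ (forall p, In p W -> P (snd p)) /\
    vnorm (vadd (wavg y W) (vopp z)) <= eps.
Proof.
  intros Heps Hweak. apply NNPP. intro Hno.
  assert (Hfar : forall W, nonneg_weights W -> wsum W = 1 -> (forall p, In p W -> P (snd p)) ->
    eps <= vnorm (vadd (wavg y W) (vopp z))).
  { intros W H1 H2 H3. apply Rnot_lt_le. intro H. apply Hno. exists W.
    repeat split; auto. lra. }
  pose (K := fun (v : normed_premodule X) (t : R) => exists W, nonneg_weights W /\
    (forall p, In p W -> P (snd p)) /\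
    v = vadd (wavg y W) (vopp (vscal (wsum W) z)) /\ t = eps * wsum W).
  destruct (@cone_separation (normed_premodule X) (@vnorm X) K) as (f & Hadd & Hscal & Hf & HfK).
  - split; cbn.
    + apply vnorm_triangle.
    + intros t v Ht. rewrite vnorm_scal, Rabs_pos_eq by exact Ht. reflexivity.
    + intros v w. rewrite vscal_0, vadd_0. reflexivity.
  - split; [|split].
    + exists z, []. split; [constructor|]. split; [intros p []|]. cbn. split; [vec|ring].
    + intros v t w s (W1 & H1 & H2 & -> & ->) (W2 & H3 & H4 & -> & ->).
      exists (W1 ++ W2). split; [apply Forall_app; auto|]. split.
      * intros p Hp. apply in_app_or in Hp. destruct Hp; auto.
      * rewrite wsum_app, wavg_app. cbn. split; [vec|ring].
    + intros c v t Hc (W & H1 & H2 & -> & ->). exists (wscale c W).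
      split; [apply wscale_nonneg; [lra|exact H1]|]. split.
      * intros p Hp. destruct (snd_wscale _ _ _ Hp) as (q & Hq & <-). auto.
      * rewrite wsum_wscale, wavg_wscale. cbn. split; [vec|ring].
  - intros v t (W & H1 & H2 & -> & ->).
    (* Positive total weight is normalised to 1; with total weight zero the demand is zero. *)
    destruct (wsum_nonneg H1) as [Hpos|Hz].
    + pose proof (Rinv_0_lt_compat _ Hpos) as Hinv.
      assert (H := Hfar (wscale (/ wsum W) W)).
      rewrite wsum_wscale, wavg_wscale, Rinv_l in H by lra.
      replace (vadd (wavg y W) _) with
        (vscal (wsum W) (vadd (vscal (/ wsum W) (wavg y W)) (vopp z))).
      * rewrite vnorm_scal, Rabs_pos_eq, Rmult_comm by lra.
        apply Rmult_le_compat_l; [lra|]. apply H; [apply wscale_nonneg; [lra|exact H1]|reflexivity|].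
        intros p Hp. destruct (snd_wscale _ _ _ Hp) as (q & Hq & <-). auto.
      * transitivity (vadd (vscal (wsum W * / wsum W) (wavg y W)) (vopp (vscal (wsum W) z))); [vec|].
        rewrite Rinv_r, vscal_1 by lra. reflexivity.
    + rewrite <- Hz, Rmult_0_r. apply vnorm_nonneg.
  - destruct (Hweak f) with (e := eps) as (a & HPa & Ha).
    + split; [exact Hadd|]. split; [exact Hscal|]. exists 1. intro v.
      rewrite Rmult_1_l. apply Rabs_le. split; [|apply Hf].
      specialize (Hf (vscal (-1) v)). specialize (Hscal (-1) v). cbn in Hscal.
      rewrite Hscal, vnorm_scal, Rabs_left in Hf by lra. lra.
    + exact Heps.
    + assert (H := HfK (vadd (y a) (vscal (-1) z)) eps).
      specialize (Hadd (y a) (vscal (-1) z)). specialize (Hscal (-1) z). cbn in Hadd, Hscal.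
      rewrite Hadd, Hscal in H.
      assert (HK : K (vadd (y a) (vscal (-1) z)) eps).
      { exists [(1, a)]. split; [constructor; [cbn; lra|constructor]|]. split.
        - intros p [<-|[]]. exact HPa.
        - cbn. split; [vec|ring]. }
      specialize (H HK). apply Rabs_def2 in Ha. lra.
Qed.

End WeightedSums.

(** [plegma] compares only neighbouring or extreme members. With all pairs compared, the property
    passes to subfamilies by mere reindexing. *)
Definition plegma_pairs (k : nat) (ss : list (list nat)) : Prop :=
  (forall i j j', (i < k)%nat -> (j < j')%nat -> (j' < length ss)%nat ->
      (nth i (nth j ss []) 0 < nth i (nth j' ss []) 0)%nat) /\
  (forall i j j', (S i < k)%nat -> (j < length ss)%nat -> (j' < length ss)%nat ->
      (nth i (nth j ss []) 0 < nth (S i) (nth j' ss []) 0)%nat).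

Lemma plegma_pairs_plegma k ss : plegma_pairs k ss -> plegma k ss.
Proof.
  intros [H1 H2]. split.
  - intros i j Hi Hj. apply H1; lia.
  - intros i Hi Hl. apply H2; lia.
Qed.

Lemma plegma_pairs_reindex k ss ss' (h : nat -> nat) : plegma_pairs k ss ->
  (forall j, (j < length ss')%nat -> (h j < length ss)%nat /\ nth j ss' [] = nth (h j) ss []) ->
  (forall j j', (j < j')%nat -> (h j < h j')%nat) ->
  plegma_pairs k ss'.
Proof.
  intros [H1 H2] Hh Hmono. split.
  - intros i j j' Hi Hj Hj'.
    destruct (Hh j) as [Hl ->]; [lia|]. destruct (Hh j') as [Hl' ->]; [lia|]. auto.
  - intros i j j' Hi Hj Hj'.
    destruct (Hh j) as [Hl ->]; [lia|]. destruct (Hh j') as [Hl' ->]; [lia|]. auto.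
Qed.

Lemma plegma_pairs_delete k ss1 ss2 ss3 :
  plegma_pairs k (ss1 ++ ss2 ++ ss3) -> plegma_pairs k (ss1 ++ ss3).
Proof.
  intro H. apply plegma_pairs_reindex with (1 := H)
    (h := fun j => if Nat.ltb j (length ss1) then j else (length ss2 + j)%nat).
  - intros j Hj. rewrite !length_app in *. destruct (Nat.ltb_spec j (length ss1)).
    + split; [lia|]. rewrite !app_nth1 by lia. reflexivity.
    + split; [lia|]. rewrite !(app_nth2 ss1) by lia. rewrite app_nth2 by lia.
      f_equal. lia.
  - intros j j' Hj. destruct (Nat.ltb_spec j (length ss1)), (Nat.ltb_spec j' (length ss1)); lia.
Qed.

Definition selection {A : Type} (Ts : list (list (R * A))) (ss : list A) : Prop :=
  Forall2 (fun T s => In s (map snd T)) Ts ss.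

Fixpoint snocs (ss : list (list nat)) (ns : list nat) : list (list nat) :=
  match ss, ns with
  | s :: ss', n :: ns' => (s ++ [n]) :: snocs ss' ns'
  | _, _ => []
  end.

Fixpoint chain (B : nat) (ns : list nat) : Prop :=
  match ns with
  | [] => True
  | n :: ns' => (B < n)%nat /\ chain n ns'
  end.

Lemma chain_lt B ns j : chain B ns -> (j < length ns)%nat -> (B < nth j ns 0)%nat.
Proof.
  revert B j; induction ns as [|n ns IH]; intros B j H Hj; simpl in *; [lia|].
  destruct H as [H1 H2]. destruct j as [|j]; [exact H1|].
  specialize (IH n j H2). lia.
Qed.

Lemma chain_mono B B' ns : (B <= B')%nat -> chain B' ns -> chain B ns.
Proof. destruct ns; simpl; [auto|]. intros H [H1 H2]. split; [lia|exact H2]. Qed.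

Lemma chain_incr B ns j j' : chain B ns -> (j < j')%nat -> (j' < length ns)%nat ->
  (nth j ns 0 < nth j' ns 0)%nat.
Proof.
  revert B j j'; induction ns as [|n ns IH]; intros B j j' H Hj Hj'; simpl in *; [lia|].
  destruct H as [H1 H2]. destruct j' as [|j']; [lia|]. destruct j as [|j].
  - apply (@chain_lt n ns j' H2). lia.
  - apply (IH n); [exact H2|lia|lia].
Qed.

Lemma length_snocs ss ns : length ns = length ss -> length (snocs ss ns) = length ss.
Proof.
  revert ns; induction ss as [|s ss IH]; intros [|n ns] H; simpl in *; try lia.
  rewrite IH; lia.
Qed.

Lemma nth_snocs ss ns j : length ns = length ss -> (j < length ss)%nat ->
  nth j (snocs ss ns) [] = nth j ss [] ++ [nth j ns 0%nat].
Proof.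
  revert ns j; induction ss as [|s ss IH]; intros [|n ns] [|j] H Hj; simpl in *; try lia.
  - reflexivity.
  - apply IH; lia.
Qed.

(** The new entries form one increasing column lying entirely above [B], hence above all old
    entries; this gives both kinds of inequality for the new column. *)
Lemma plegma_pairs_snocs i B ss ns : plegma_pairs i ss -> length ns = length ss ->
  (forall s, In s ss -> length s = i /\ forall n, In n s -> (n <= B)%nat) -> chain B ns ->
  plegma_pairs (S i) (snocs ss ns).
Proof.
  intros [H1 H2] Hlen Hss Hch.
  assert (Hs : forall j, (j < length ss)%nat -> length (nth j ss []) = i /\
    forall i', (i' < i)%nat -> (nth i' (nth j ss []) 0 <= B)%nat).
  { intros j Hj. destruct (Hss (nth j ss [])) as [Hl Hb]; [apply nth_In, Hj|].
    split; [exact Hl|]. intros i' Hi'. apply Hb, nth_In. lia. }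
  split; rewrite length_snocs by exact Hlen.
  - intros i' j j' Hi Hj Hj'. rewrite !nth_snocs by lia.
    destruct (Hs j) as [Hl Hb]; [lia|]. destruct (Hs j') as [Hl' Hb']; [lia|].
    destruct (Nat.eq_dec i' i) as [->|Hne].
    + rewrite !app_nth2, Hl, Hl', Nat.sub_diag by lia. cbn. apply (@chain_incr B); auto. lia.
    + rewrite !app_nth1 by lia. apply H1; lia.
  - intros i' j j' Hi Hj Hj'. rewrite !nth_snocs by lia.
    destruct (Hs j) as [Hl Hb]; [lia|]. destruct (Hs j') as [Hl' Hb']; [lia|].
    rewrite (app_nth1 (nth j ss [])) by lia.
    destruct (Nat.eq_dec (S i') i) as [He|Hne].
    + rewrite app_nth2, Hl', He, Nat.sub_diag by lia. cbn.
      apply Nat.le_lt_trans with B; [apply Hb; lia|]. apply chain_lt; [exact Hch|lia].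
    + rewrite app_nth1 by lia. apply H2; lia.
Qed.

Lemma incr_list_snoc s n : incr_list s -> (forall m, In m s -> (m < n)%nat) ->
  incr_list (s ++ [n]).
Proof.
  intros Hs Hn i Hi. rewrite length_app in Hi. cbn in Hi.
  destruct (Nat.eq_dec (S i) (length s)) as [He|Hne].
  - rewrite (app_nth1 s) by lia. rewrite app_nth2, He, Nat.sub_diag by lia. cbn.
    apply Hn, nth_In. lia.
  - rewrite !app_nth1 by lia. apply Hs. lia.
Qed.

Lemma strictly_increasing_ge M : strictly_increasing M -> forall i, (i <= M i)%nat.
Proof.
  intros HM i. induction i as [|i IH]; [lia|]. specialize (HM i (S i)). lia.
Qed.

Lemma exists_bound B (ss : list (list nat)) :
  exists B', (B <= B')%nat /\ forall s n, In s ss -> In n s -> (n <= B')%nat.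
Proof.
  exists (Nat.max B (list_max (concat ss))). split; [lia|]. intros s n Hs Hn.
  enough (n <= list_max (concat ss))%nat by lia.
  assert (H := proj1 (list_max_le (concat ss) _) (Nat.le_refl _)).
  rewrite Forall_forall in H. apply H, in_concat. eauto.
Qed.

(** The lower bound is imposed on every member, not only on the first, so that it survives deletion
    of members. *)
Definition far_plegma (k : nat) (L : nat -> nat) (l : nat) (ss : list (list nat)) : Prop :=
  plegma_pairs k ss /\ forall s, In s ss -> in_Mk L k s /\ (L l <= nth 0 s 0)%nat.

Lemma far_plegma_delete k L l ss1 ss2 ss3 :
  far_plegma k L l (ss1 ++ ss2 ++ ss3) -> far_plegma k L l (ss1 ++ ss3).
Proof.
  intros [H1 H2]. split; [apply plegma_pairs_delete with (1 := H1)|].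
  intros s Hs. apply H2. rewrite !in_app_iff in *. tauto.
Qed.

(** * Construction of grids level by level *)

Section Grids.
Context {X : NormedSpace} (k : nat) (phi : list nat -> X).
Context (Hphi : weakly_continuous_on_Nlek k phi).
Context (L : nat -> nat) (HL : strictly_increasing L).
Context (l : nat).

Definition node (i B : nat) (t : list nat) : Prop :=
  length t = i /\ incr_list t /\
  forall n, In n t -> (exists q, L q = n) /\ (L l <= n)%nat /\ (n <= B)%nat.

Definition good (i : nat) (eta : R) (B : nat) (T : list (R * list nat)) : Prop :=
  nonneg_weights T /\ wsum T = 1 /\ vnorm (vadd (wavg phi T) (vopp (phi []))) <= eta /\
  forall p, In p T -> node i B (snd p).

Lemma good_mono i eta B B' T : (B <= B')%nat -> good i eta B T -> good i eta B' T.
Proof.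
  intros HB (H1 & H2 & H3 & H4). repeat split; auto; destruct (H4 _ H) as (H5 & H6 & H7); auto;
    destruct (H7 _ H0) as (H8 & H9 & H10); auto. lia.
Qed.

(** As [n] grows, [t ++ [n]] converges to [t] in the topology of finite sets, so Mazur's theorem
    applies to the successors of [t]. Only successors beyond [B] are used, which leaves room for
    interlacing. *)
Lemma node_successors i B t eps : (i < k)%nat -> node i B t -> 0 < eps ->
  exists W, nonneg_weights W /\ wsum W = 1 /\
    (forall p, In p W -> exists n, snd p = t ++ [n] /\ (B < n)%nat /\ exists q, L q = n) /\
    vnorm (vadd (wavg phi W) (vopp (phi t))) <= eps.
Proof.
  intros Hi (Hlen & Hinc & Ht) Heps.
  apply (@mazur _ _ phi
    (fun s => exists n, s = t ++ [n] /\ (B < n)%nat /\ exists q, L q = n)); [exact Heps|].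
  intros f Hf e He.
  destruct (Hphi Hf (s := t)) with (eps := e) as (n1 & Hn1); [split; [exact Hinc|lia]|exact He|].
  (* Beyond [n1] the new element cannot be seen by the neighbourhood of [t]; beyond [B] it keeps the
     list increasing. *)
  pose (n := L (S (Nat.max n1 B))).
  assert (Hn : (S (Nat.max n1 B) <= n)%nat) by (apply strictly_increasing_ge, HL).
  exists (t ++ [n]). split.
  - exists n. split; [reflexivity|]. split; [lia|]. eexists; reflexivity.
  - apply Hn1.
    + split; [|rewrite length_app; cbn; lia]. apply incr_list_snoc; [exact Hinc|].
      intros m Hm. destruct (Ht _ Hm) as (_ & _ & H). lia.
    + intros i' Hi'. rewrite in_app_iff. cbn. split; [auto|]. intros [H|[H|[]]]; [auto|lia].
Qed.

Lemma extend_weighted i B T eps : (i < k)%nat -> 0 < eps -> nonneg_weights T ->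
  (forall p, In p T -> node i B (snd p)) ->
  exists T', nonneg_weights T' /\ wsum T' = wsum T /\
    vnorm (vadd (wavg phi T') (vopp (wavg phi T))) <= eps * wsum T /\
    forall p', In p' T' -> exists p n, In p T /\ snd p' = snd p ++ [n] /\ (B < n)%nat /\
      exists q, L q = n.
Proof.
  intros Hi Heps. induction 1 as [|[w t] T Hw HT IH]; intro Hnode.
  - exists []. split; [constructor|]. split; [reflexivity|]. split; [|intros p' []].
    cbn. rewrite vadd_opp, vnorm_zero. lra.
  - destruct IH as (T' & H1 & H2 & H3 & H4); [intros p Hp; apply Hnode; right; exact Hp|].
    destruct (@node_successors i B t eps) as (W & H5 & H6 & H7 & H8);
      [exact Hi|apply (Hnode (w, t)); left; reflexivity|exact Heps|].
    cbn [fst] in Hw.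
    exists (wscale w W ++ T'). split; [apply Forall_app; split; [apply wscale_nonneg; auto|exact H1]|].
    split; [rewrite wsum_app, wsum_wscale, wsum_cons, H6, H2; cbn [fst]; ring|]. split.
    + rewrite wavg_app, wavg_wscale, wavg_cons, wsum_cons. cbn [fst snd].
      replace (vadd _ _) with (vadd (vscal w (vadd (wavg phi W) (vopp (phi t))))
        (vadd (wavg phi T') (vopp (wavg phi T)))) by vec.
      eapply Rle_trans; [apply vnorm_triangle|].
      rewrite vnorm_scal, Rabs_pos_eq by exact Hw.
      apply (Rmult_le_compat_l w) in H8; [|exact Hw]. lra.
    + intros p' Hp'. apply in_app_or in Hp'. destruct Hp' as [Hp'|Hp'].
      * destruct (snd_wscale _ _ _ Hp') as (q & Hq & <-).
        destruct (H7 _ Hq) as (n & Hn & HB & HLn). exists (w, t), n.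
        split; [left; reflexivity|]. auto.
      * destruct (H4 _ Hp') as (p & n & Hp & Hr). exists p, n. split; [right; exact Hp|exact Hr].
Qed.

Lemma extend_good i eta B T eps : (i < k)%nat -> 0 < eps -> (L l <= B)%nat -> good i eta B T ->
  exists T' B', (B <= B')%nat /\ good (S i) (eta + eps) B' T' /\
    forall p', In p' T' -> exists p n, In p T /\ snd p' = snd p ++ [n] /\ (B < n <= B')%nat.
Proof.
  intros Hi Heps HB (H1 & H2 & H3 & H4).
  destruct (@extend_weighted i B T eps Hi Heps H1 H4) as (T' & H5 & H6 & H7 & H8).
  destruct (exists_bound B (map snd T')) as (B' & HB' & Hbd).
  assert (Hbd' : forall p n, In p T' -> In n (snd p) -> (n <= B')%nat).
  { intros p n Hp Hn. apply (Hbd (snd p)); [apply in_map, Hp|exact Hn]. }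
  exists T', B'. split; [exact HB'|]. split.
  - split; [exact H5|]. split; [lra|]. split.
    + replace (vadd _ _) with (vadd (vadd (wavg phi T') (vopp (wavg phi T)))
        (vadd (wavg phi T) (vopp (phi [])))) by vec.
      eapply Rle_trans; [apply vnorm_triangle|]. rewrite H2 in H7. lra.
    + intros p' Hp'. pose proof (fun n => Hbd' p' n Hp') as Hb.
      destruct (H8 _ Hp') as (p & n & Hp & He & HBn & HLn). rewrite He in *.
      destruct (H4 _ Hp) as (H9 & H10 & H11).
      split; [rewrite length_app, H9; cbn; lia|]. split.
      * apply incr_list_snoc; [exact H10|]. intros m Hm. destruct (H11 _ Hm) as (_ & _ & H). lia.
      * intros m Hm. pose proof (Hb _ Hm) as Hmb. apply in_app_or in Hm.
        destruct Hm as [Hm|[<-|[]]].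
        -- destruct (H11 _ Hm) as (Ha & Hc & _). auto.
        -- split; [exact HLn|]. split; [lia|exact Hmb].
  - intros p' Hp'. destruct (H8 _ Hp') as (p & n & Hp & He & HBn & _).
    exists p, n. split; [exact Hp|]. split; [exact He|]. split; [exact HBn|].
    apply (Hbd' p' n Hp'). rewrite He. apply in_or_app. right. left. reflexivity.
Qed.

(** The combinations are extended from left to right, each beyond the bound [B1] left by its
    predecessor. Whatever successor is picked in each of them, the picked entries increase along the
    row. *)
Lemma extend_row i eta Ts eps : (i < k)%nat -> 0 < eps -> forall B, (L l <= B)%nat ->
  Forall (good i eta B) Ts ->
  exists Ts' B', (B <= B')%nat /\ length Ts' = length Ts /\
    Forall (good (S i) (eta + eps) B') Ts' /\
    forall ss', selection Ts' ss' -> exists ss ns, selection Ts ss /\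
      length ns = length ss /\ ss' = snocs ss ns /\ chain B ns.
Proof.
  intros Hi Heps. induction Ts as [|T Ts IH]; intros B HB HTs.
  - exists [], B. split; [lia|]. split; [reflexivity|]. split; [constructor|].
    intros ss' H. inversion H. exists [], []. repeat split. constructor.
  - apply Forall_cons_iff in HTs. destruct HTs as [HT HTs].
    destruct (@extend_good i eta B T eps Hi Heps HB HT) as (T' & B1 & HB1 & HT' & Hext).
    destruct (IH B1) as (Ts' & B' & HB' & Hlen & HTs' & Hsel); [lia| |].
    { apply Forall_impl with (2 := HTs). intro. apply good_mono, HB1. }
    exists (T' :: Ts'), B'. split; [lia|]. split; [cbn; lia|]. split.
    + constructor; [apply good_mono with (1 := HB'), HT'|exact HTs'].
    + intros ss' H. inversion H as [|? s ? ss0 Hs Hss0]; subst.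
      destruct (Hsel _ Hss0) as (ss & ns & H1 & H2 & -> & H3).
      apply in_map_iff in Hs. destruct Hs as (p' & <- & Hp').
      destruct (Hext _ Hp') as (p & n & Hp & -> & Hn).
      exists (snd p :: ss), (n :: ns). split; [constructor; [apply in_map, Hp|exact H1]|].
      split; [cbn; lia|]. split; [reflexivity|]. split; [lia|].
      apply chain_mono with (2 := H3). lia.
Qed.

Lemma selection_node i eta B Ts ss : Forall (good i eta B) Ts -> selection Ts ss ->
  forall s, In s ss -> node i B s.
Proof.
  intros HTs H. induction H as [|T s Ts ss Hs H IH]; [intros s []|].
  apply Forall_cons_iff in HTs. destruct HTs as [HT HTs].
  intros s' [<-|Hs']; [|apply IH; assumption].
  apply in_map_iff in Hs. destruct Hs as (p & <- & Hp). apply HT, Hp.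
Qed.

(** All [m] combinations receive one further entry before any receives the next; this is the order
    in which the entries of a plegma family occur in the natural numbers. Each level costs an error
    [eps]. *)
Lemma exists_rows m eps i : 0 < eps -> (i <= k)%nat ->
  exists Ts B, (L l <= B)%nat /\ length Ts = m /\ Forall (good i (INR i * eps) B) Ts /\
    forall ss, selection Ts ss -> plegma_pairs i ss.
Proof.
  intro Heps. induction i as [|i IH]; intro Hi.
  (* At level zero each combination is the single empty set, whose average is exactly [phi []]. The
     initial bound [L l] forces all later entries beyond it. *)
  - exists (repeat [(1, [])] m), (L l). split; [lia|]. split; [apply repeat_length|]. split.
    + apply Forall_forall. intros T HT. apply repeat_spec in HT. subst T.
      split; [constructor; [cbn; lra|constructor]|]. split; [cbn; lra|]. split.
      * cbn. replace (vadd _ _) with (vzero : X) by vec. rewrite vnorm_zero. lra.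
      * intros p [<-|[]]. split; [reflexivity|]. split; [|intros n []].
        intros j Hj. cbn in Hj. lia.
    + intros ss _. split; intros; lia.
  - destruct IH as (Ts & B & HB & Hlen & HTs & Hpl); [lia|].
    destruct (@extend_row i (INR i * eps) Ts eps Hi Heps B HB HTs)
      as (Ts' & B' & HB' & Hlen' & HTs' & Hsel).
    exists Ts', B'. split; [lia|]. split; [lia|]. split.
    + rewrite S_INR, Rmult_plus_distr_r, Rmult_1_l. exact HTs'.
    + intros ss' Hss'. destruct (Hsel _ Hss') as (ss & ns & H1 & H2 & -> & H3).
      apply plegma_pairs_snocs with B; [apply Hpl, H1|exact H2| |exact H3].
      intros s Hs. destruct (selection_node HTs H1 _ Hs) as (H4 & _ & H5).
      split; [exact H4|]. intros n Hn. apply H5, Hn.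
Qed.

End Grids.

(* [Ts] is a list of convex combinations, each approximating [x0], such that
   choosing one index out of each always yields a plegma family. *)
Definition grid {X : NormedSpace} (k : nat) (x : list nat -> X) (x0 : X) (L : nat -> nat)
    (l : nat) (eps : R) (Ts : list (list (R * list nat))) : Prop :=
  Forall (fun T => nonneg_weights T /\ wsum T = 1 /\
    vnorm (vadd (wavg x T) (vopp x0)) <= eps) Ts /\
  forall ss, selection Ts ss -> far_plegma k L l ss.

Lemma wavg_ext {A : Type} {X : NormedSpace} (y y' : A -> X) W :
  (forall p, In p W -> y (snd p) = y' (snd p)) -> wavg y W = wavg y' W.
Proof.
  induction W as [|p W IH]; intro H; cbn; [reflexivity|].
  rewrite (H p) by (left; reflexivity). f_equal. apply IH. intros q Hq. apply H. right. exact Hq.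
Qed.

Lemma exists_grid {X : NormedSpace} k (x : list nat -> X) x0 L :
  (1 <= k)%nat -> subordinated_weak k x x0 -> strictly_increasing L ->
  forall l m eps, 0 < eps -> exists Ts, length Ts = m /\ grid k x x0 L l eps Ts.
Proof.
  intros Hk (phi & Hphi & Hx & Hx0) HL l m eps Heps.
  assert (HkR : 0 < INR k) by (apply lt_0_INR; lia).
  assert (He : 0 < eps / INR k) by (apply Rdiv_lt_0_compat; assumption).
  destruct (@exists_rows X k phi Hphi L HL l m (eps / INR k) k He (Nat.le_refl k))
    as (Ts & B & HB & Hlen & HTs & Hpl).
  assert (Hnode : forall s, node L l k B s -> in_Mk L k s /\ (L l <= nth 0 s 0)%nat).
  { intros s (H1 & H2 & H3). split.
    - split; [exact H2|]. split; [exact H1|]. intros n Hn. apply H3, Hn.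
    - apply H3, nth_In. lia. }
  exists Ts. split; [exact Hlen|]. split.
  - apply Forall_impl with (2 := HTs). intros T (H1 & H2 & H3 & H4).
    split; [exact H1|]. split; [exact H2|].
    replace (INR k * (eps / INR k)) with eps in H3 by (field; lra).
    rewrite <- Hx0. rewrite <- (@wavg_ext _ _ phi x); [exact H3|].
    intros p Hp. apply Hx. destruct (Hnode _ (H4 _ Hp)) as [(H5 & H6 & _) _].
    split; [exact H5|]. split; [exact H6|]. intros n _. exists n. reflexivity.
  - intros ss Hss. split; [apply Hpl, Hss|]. intros s Hs.
    apply Hnode. apply (selection_node HTs Hss _ Hs).
Qed.

(** * Consequences for spreading models *)

Lemma lsum_app a b : lsum (a ++ b) = lsum a + lsum b.
Proof. induction a as [|c a IH]; simpl; [ring|rewrite IH; ring]. Qed.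

Lemma lsum_lscal c a : lsum (lscal c a) = c * lsum a.
Proof. induction a as [|d a IH]; simpl; [ring|rewrite IH; ring]. Qed.

Lemma lsum_zeros n : lsum (repeat 0 n) = 0.
Proof. induction n as [|n IH]; simpl; [ring|rewrite IH; ring]. Qed.

Lemma l1norm_nonneg a : 0 <= l1norm a.
Proof.
  induction a as [|c a IH]; simpl; [lra|]. pose proof (Rabs_pos c). lra.
Qed.

Lemma l1norm_app a b : l1norm (a ++ b) = l1norm a + l1norm b.
Proof. induction a as [|c a IH]; simpl; [ring|rewrite IH; ring]. Qed.

Lemma l1norm_lscal c a : l1norm (lscal c a) = Rabs c * l1norm a.
Proof. induction a as [|d a IH]; simpl; [ring|rewrite IH, Rabs_mult; ring]. Qed.

Lemma in_l1norm c a : In c a -> Rabs c <= l1norm a.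
Proof.
  induction a as [|d a IH]; [intros []|]. intros [->|H]; simpl.
  - pose proof (l1norm_nonneg a). lra.
  - specialize (IH H). pose proof (Rabs_pos d). lra.
Qed.

Lemma length_lscal c a : length (lscal c a) = length a.
Proof. apply length_map. Qed.

Section Comb.
Context {X : NormedSpace} (x : list nat -> X).

Lemma comb_app ss1 ss2 a1 a2 : length ss1 = length a1 ->
  comb x (ss1 ++ ss2) (a1 ++ a2) = vadd (comb x ss1 a1) (comb x ss2 a2).
Proof.
  revert a1; induction ss1 as [|s ss1 IH]; intros [|c a1] H; simpl in *; try lia.
  - symmetry. apply vadd_0_l.
  - rewrite IH by lia. vec.
Qed.

Lemma comb_lscal c ss a : comb x ss (lscal c a) = vscal c (comb x ss a).
Proof.
  revert a; induction ss as [|s ss IH]; intros [|d a]; simpl; try (symmetry; apply vscal_zero).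
  rewrite IH. vec.
Qed.

Lemma comb_zeros n ss : comb x ss (repeat 0 n) = vzero.
Proof.
  revert n; induction ss as [|s ss IH]; intros [|n]; simpl; try reflexivity.
  rewrite IH, vscal_0. apply vadd_0.
Qed.

Lemma comb_translate (x0 : X) ss a : length ss = length a ->
  comb (fun s => vadd (x s) (vopp x0)) ss a = vadd (comb x ss a) (vopp (vscal (lsum a) x0)).
Proof.
  revert a; induction ss as [|s ss IH]; intros [|d a] H; simpl in *; try lia.
  - vec.
  - rewrite IH by lia. vec.
Qed.

End Comb.

Lemma far_plegma_mono k L l l' ss : strictly_increasing L -> (l <= l')%nat ->
  far_plegma k L l' ss -> far_plegma k L l ss.
Proof.
  intros HL Hl [H1 H2]. split; [exact H1|]. intros s Hs. destruct (H2 s Hs) as [H3 H4].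
  split; [exact H3|]. destruct (Nat.eq_dec l l') as [->|Hne]; [exact H4|].
  specialize (HL l l'). lia.
Qed.

(** Homogeneity removes the restriction of the coefficients to [[-1,1]]: the vector is divided by
    [c], and [l] is taken so large that [delta l] is below [eta / c]. *)
Lemma generates_far {X : NormedSpace} k (x : list nat -> X) L N :
  strictly_increasing L -> is_seminorm N -> generates k x L N ->
  forall a eta, 0 < eta -> exists l, forall ss, length ss = length a -> far_plegma k L l ss ->
    Rabs (vnorm (comb x ss a) - N a) <= eta.
Proof.
  intros HL (_ & Hscal & _) (delta & Hpos & Hlim & Hgen) a eta Heta.
  pose (c := l1norm a + 1).
  assert (Hc : 0 < c) by (unfold c; pose proof (l1norm_nonneg a); lra).
  assert (Hic : 0 < / c) by (apply Rinv_0_lt_compat, Hc).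
  destruct (Hlim (eta * / c)) as (n0 & Hn0); [apply Rmult_lt_0_compat; assumption|].
  (* [length a] enters because at [l] only families of at most [S l] members are controlled. *)
  pose (l := Nat.max n0 (length a)). exists l. intros ss Hlen [Hpl Hss].
  assert (H : Rabs (vnorm (comb x ss (lscal (/ c) a)) - N (lscal (/ c) a)) <= delta l).
  { apply Hgen.
    - lia.
    - rewrite length_lscal. lia.
    - apply plegma_pairs_plegma, Hpl.
    - intros s Hs. apply Hss, Hs.
    - intro Hne. destruct ss as [|s ss]; [congruence|]. apply Hss. left. reflexivity.
    - intros d Hd. apply in_map_iff in Hd. destruct Hd as (e & <- & He).
      enough (Rabs (/ c * e) <= 1) as Hle by (apply Rabs_le_inv in Hle; lra).
      rewrite Rabs_mult, (Rabs_pos_eq (/ c)) by lra.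
      apply Rmult_le_reg_l with c; [exact Hc|].
      rewrite <- Rmult_assoc, Rinv_r, Rmult_1_l by lra.
      pose proof (in_l1norm _ _ He). unfold c. lra. }
  rewrite comb_lscal, vnorm_scal, Hscal, <- Rmult_minus_distr_l, Rabs_mult, Rabs_Rabsolu in H.
  rewrite (Rabs_pos_eq (/ c)) in H by lra.
  specialize (Hn0 l). unfold Rdist in Hn0. rewrite Rminus_0_r in Hn0.
  assert (Hd : delta l < eta * / c).
  { apply Rle_lt_trans with (1 := Rle_abs _). apply Hn0. unfold l. lia. }
  apply Rmult_le_reg_l with (/ c); [exact Hic|]. lra.
Qed.

Lemma infinite_subset_ge L M : strictly_increasing M -> infinite_subset_of L M ->
  forall l, (M l <= L l)%nat.
Proof.
  intros HM [HL Hsub] l.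
  enough (forall l j, L l = M j -> (l <= j)%nat) as H.
  { destruct (Hsub l) as [j Hj]. specialize (H l j Hj).
    destruct (Nat.eq_dec l j) as [->|Hne]; [lia|]. specialize (HM l j). lia. }
  clear l. induction l as [|l IH]; intros j Hj; [lia|].
  destruct (Hsub l) as [j' Hj']. specialize (IH _ Hj').
  assert (Hlt : (L l < L (S l))%nat) by (apply HL; lia).
  destruct (Nat.le_gt_cases j j') as [Hle|Hgt]; [|lia].
  destruct (Nat.eq_dec j j') as [->|Hne]; [lia|]. specialize (HM j j'). lia.
Qed.

(** The same [delta] serves, because [M l <= L l] makes the starting condition for [L] the stronger
    one. *)
Lemma generates_subset {X : NormedSpace} k (x : list nat -> X) L M N :
  strictly_increasing M -> infinite_subset_of L M -> generates k x M N -> generates k x L N.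
Proof.
  intros HM HLM (delta & Hpos & Hlim & Hgen). exists delta. split; [exact Hpos|].
  split; [exact Hlim|]. intros l ss a H1 H2 H3 H4 H5 H6. apply Hgen; auto.
  - intros s Hs. destruct (H4 s Hs) as (H7 & H8 & H9). split; [exact H7|]. split; [exact H8|].
    intros n Hn. destruct (H9 n Hn) as [i <-]. destruct HLM as [_ HLM].
    destruct (HLM i) as [j Hj]. exists j. auto.
  - intro Hne. specialize (H5 Hne). pose proof (infinite_subset_ge HM HLM l). lia.
Qed.

(** Deleted coordinates remain as zeros, so one index family serves both [a] and [b]. *)
Definition subvector (b a : list R) : Prop := Forall2 (fun c d => d = c \/ d = 0) a b.

(** Coordinates are processed one at a time, [y0] collecting the finished part. A kept coordinate is
    fixed at its index; a deleted one is averaged over its whole combination, which convexity allows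
    because the bound [D] holds for every selection. *)
Lemma comb_partial_average {X : NormedSpace} (x : list nat -> X) (x0 : X) eps a b :
  0 <= eps -> subvector b a -> forall Ts,
  Forall (fun T => nonneg_weights T /\ wsum T = 1 /\
    vnorm (vadd (wavg x T) (vopp x0)) <= eps) Ts ->
  length Ts = length a -> forall y0 D,
  (forall ss, selection Ts ss -> vnorm (vadd y0 (comb x ss a)) <= D) ->
  forall t, selection Ts t ->
    vnorm (vadd (vadd y0 (comb x t b)) (vscal (lsum a - lsum b) x0)) <= D + eps * l1norm a.
Proof.
  intros Heps Hsub. induction Hsub as [|c d a b Hcd Hsub IH]; intros Ts HTs Hlen y0 D HD t Ht.
  - destruct Ts; [|discriminate Hlen]. inversion Ht; subst. simpl.
    specialize (HD [] Ht). simpl in HD.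
    replace (vadd _ _) with (vadd y0 vzero) by vec. lra.
  - destruct Ts as [|T Ts]; [discriminate Hlen|]. inversion Ht as [|? s ? t' Hs Ht']; subst.
    apply Forall_cons_iff in HTs. destruct HTs as [(HT1 & HT2 & HT3) HTs].
    simpl in Hlen. assert (Hlen' : length Ts = length a) by lia. simpl.
    destruct Hcd as [-> | ->].
    + assert (H := IH Ts HTs Hlen' (vadd y0 (vscal c (x s))) D).
      replace (vadd _ _) with (vadd (vadd (vadd y0 (vscal c (x s))) (comb x t' b))
        (vscal (lsum a - lsum b) x0)) by vec.
      apply Rle_trans with (D + eps * l1norm a).
      * apply H; [|exact Ht']. intros ss Hss.
        replace (vadd _ _) with (vadd y0 (comb x (s :: ss) (c :: a))) by (simpl; vec).
        apply HD. constructor; assumption.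
      * pose proof (Rmult_le_pos _ _ Heps (Rabs_pos c)). lra.
    (* Replacing the average by [x0] costs [eps * Rabs c]; these costs add up to
       [eps * l1norm a]. *)
    + assert (H := IH Ts HTs Hlen' (vadd y0 (vscal c x0)) (D + eps * Rabs c)).
      replace (vadd _ _) with (vadd (vadd (vadd y0 (vscal c x0)) (comb x t' b))
        (vscal (lsum a - lsum b) x0)) by vec.
      rewrite Rmult_plus_distr_l, <- Rplus_assoc. apply H; [|exact Ht'].
      intros ss Hss.
      assert (Havg := @vnorm_wavg_le _ _ x T (vadd y0 (comb x ss a)) c D HT1).
      rewrite HT2, Rmult_1_l in Havg.
      replace (vadd _ _) with (vadd (vadd (vscal 1 (vadd y0 (comb x ss a))) (vscal c (wavg x T)))
        (vscal (- c) (vadd (wavg x T) (vopp x0)))) by vec.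
      eapply Rle_trans; [apply vnorm_triangle|]. rewrite vnorm_scal, Rabs_Ropp.
      apply Rplus_le_compat.
      * apply Havg. intros p Hp.
        replace (vadd _ _) with (vadd y0 (comb x (snd p :: ss) (c :: a))) by (simpl; vec).
        apply HD. constructor; [apply in_map, Hp|exact Hss].
      * rewrite Rmult_comm. apply Rmult_le_compat_r; [apply Rabs_pos|exact HT3].
Qed.

Lemma grid_selection {X : NormedSpace} k (x : list nat -> X) x0 L l eps Ts :
  grid k x x0 L l eps Ts -> exists ss, selection Ts ss.
Proof.
  intros [H _]. induction H as [|T Ts (H1 & H2 & H3) H IH].
  - exists []. constructor.
  - destruct IH as [ss Hss]. destruct T as [|p T]; [cbn in H2; lra|].
    exists (snd p :: ss). constructor; [left; reflexivity|exact Hss].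
Qed.

Lemma selection_length {A : Type} (Ts : list (list (R * A))) ss :
  selection Ts ss -> length ss = length Ts.
Proof. intro H. symmetry. apply (Forall2_length H). Qed.

(** A selection from the remaining combinations is completed by any selection [t2] from the deleted
    ones, and the members of [t2] are then removed. *)
Lemma grid_delete {X : NormedSpace} k (x : list nat -> X) x0 L l eps Ts1 Ts2 Ts3 :
  grid k x x0 L l eps (Ts1 ++ Ts2 ++ Ts3) -> grid k x x0 L l eps (Ts1 ++ Ts3).
Proof.
  intros HG. destruct (grid_selection HG) as [t Ht]. destruct HG as [H1 H2].
  apply Forall2_app_inv_l in Ht. destruct Ht as (t1 & t' & _ & Ht' & ->).
  apply Forall2_app_inv_l in Ht'. destruct Ht' as (t2 & t3 & Ht2 & _ & ->).
  rewrite !Forall_app in H1. split; [rewrite Forall_app; tauto|].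
  intros ss Hss. apply Forall2_app_inv_l in Hss. destruct Hss as (s1 & s3 & Hs1 & Hs3 & ->).
  apply far_plegma_delete with t2. apply H2.
  apply Forall2_app; [exact Hs1|]. apply Forall2_app; assumption.
Qed.

Lemma split_length {A : Type} (t : list A) p q : length t = (p + q)%nat ->
  exists t1 t2, t = t1 ++ t2 /\ length t1 = p /\ length t2 = q.
Proof.
  intro H. exists (firstn p t), (skipn p t). rewrite firstn_skipn, length_firstn, length_skipn.
  split; [reflexivity|]. lia.
Qed.

(** * Estimates valid on all sufficiently far and fine grids *)

Section EventualSelections.
Context {X : NormedSpace} (k : nat) (x : list nat -> X) (x0 : X) (L : nat -> nat).
Context (Hk : (1 <= k)%nat) (Hsub : subordinated_weak k x x0) (HL : strictly_increasing L).

(** These properties behave like the members of a proper filter: they are closed under conjunction,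
    and each has a witness. *)
Definition eventually_selected (m : nat) (P : list (list nat) -> Prop) : Prop :=
  exists l eps, 0 < eps /\ forall Ts t, length Ts = m -> grid k x x0 L l eps Ts ->
    selection Ts t -> P t.

Lemma grid_mono l l' eps eps' Ts : (l <= l')%nat -> eps' <= eps ->
  grid k x x0 L l' eps' Ts -> grid k x x0 L l eps Ts.
Proof.
  intros Hl He [H1 H2]. split.
  - apply Forall_impl with (2 := H1). intros T (H3 & H4 & H5). repeat split; auto. lra.
  - intros ss Hss. apply far_plegma_mono with l'; auto.
Qed.

Lemma eventually_selected_and m P Q :
  eventually_selected m P -> eventually_selected m Q ->
  eventually_selected m (fun t => P t /\ Q t).
Proof.
  intros (l1 & e1 & H1 & HP) (l2 & e2 & H2 & HQ).
  exists (Nat.max l1 l2), (Rmin e1 e2). split; [apply Rmin_pos; assumption|].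
  intros Ts t Hm HG Ht. split.
  - apply (HP Ts); auto. apply grid_mono with (3 := HG); [lia|apply Rmin_l].
  - apply (HQ Ts); auto. apply grid_mono with (3 := HG); [lia|apply Rmin_r].
Qed.

Lemma eventually_selected_exists m P :
  eventually_selected m P -> exists t, length t = m /\ P t.
Proof.
  intros (l & e & He & HP). destruct (exists_grid Hk Hsub HL l m He) as (Ts & Hm & HG).
  destruct (grid_selection HG) as [t Ht]. exists t. split; [|apply (HP Ts); auto].
  rewrite (selection_length Ht). exact Hm.
Qed.

(** Estimates for families of different lengths can thus be read off on subfamilies of one long
    family and then combined. *)
Lemma eventually_selected_delete p q r P : eventually_selected (p + r) P ->
  eventually_selected (p + q + r) (fun t => forall t1 t2 t3, t = t1 ++ t2 ++ t3 ->
    length t1 = p -> length t2 = q -> P (t1 ++ t3)).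
Proof.
  intros (l & e & He & HP). exists l, e. split; [exact He|].
  intros Ts t Hm HG Ht t1 t2 t3 -> H1 H2.
  apply Forall2_app_inv_r in Ht. destruct Ht as (Ts1 & Ts' & Ht1 & Ht' & ->).
  apply Forall2_app_inv_r in Ht'. destruct Ht' as (Ts2 & Ts3 & Ht2 & Ht3 & ->).
  apply (HP (Ts1 ++ Ts3)).
  - pose proof (selection_length Ht1). pose proof (selection_length Ht2).
    rewrite !length_app in *. lia.
  - apply grid_delete with (1 := HG).
  - apply Forall2_app; assumption.
Qed.

Lemma eventually_selected_left p q P : eventually_selected p P ->
  eventually_selected (p + q) (fun t => forall t1 t2, t = t1 ++ t2 -> length t1 = p -> P t1).
Proof.
  intro H. rewrite <- (Nat.add_0_r p) in H.
  destruct (eventually_selected_delete p q 0 H) as (l & e & He & HP).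
  exists l, e. split; [exact He|]. intros Ts t Hm HG Ht t1 t2 -> H1.
  rewrite <- (app_nil_r t1). apply (HP Ts (t1 ++ t2 ++ [])) with (t2 := t2).
  - lia.
  - exact HG.
  - rewrite app_nil_r. exact Ht.
  - reflexivity.
  - exact H1.
  - pose proof (selection_length Ht) as H2. rewrite length_app in H2. lia.
Qed.

Lemma eventually_selected_right p q P : eventually_selected q P ->
  eventually_selected (p + q) (fun t => forall t1 t2, t = t1 ++ t2 -> length t1 = p -> P t2).
Proof.
  intro H. destruct (@eventually_selected_delete 0 p q P H) as (l & e & He & HP).
  exists l, e. split; [exact He|]. intros Ts t Hm HG Ht t1 t2 -> H1.
  apply (HP Ts (t1 ++ t2) Hm HG Ht [] t1 t2); auto.
Qed.

Lemma eventually_generates (y : list nat -> X) N : is_seminorm N -> generates k y L N ->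
  forall a eta, 0 < eta -> eventually_selected (length a)
    (fun t => Rabs (vnorm (comb y t a) - N a) <= eta).
Proof.
  intros HN Hgen a eta Heta. destruct (generates_far HL HN Hgen a Heta) as [l Hl].
  exists l, 1. split; [lra|]. intros Ts t Hm HG Ht. apply Hl.
  - rewrite (selection_length Ht). exact Hm.
  - apply HG, Ht.
Qed.

(** A member with coefficient zero contributes nothing in [X], so both sides are approximated by the
    norm of the same vector. *)
Lemma spreading_insert0 (y : list nat -> X) N : is_seminorm N -> generates k y L N ->
  forall a b, N (a ++ 0 :: b) = N (a ++ b).
Proof.
  intros HN Hgen a b.
  enough (Rabs (N (a ++ 0 :: b) - N (a ++ b)) <= 0) as H.
  { pose proof (Rabs_pos (N (a ++ 0 :: b) - N (a ++ b))).
    assert (H1 : Rabs (N (a ++ 0 :: b) - N (a ++ b)) = 0) by lra.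
    destruct (Req_dec (N (a ++ 0 :: b) - N (a ++ b)) 0) as [H2|H2]; [lra|].
    apply Rabs_no_R0 in H2. lra. }
  apply le_epsilon. intros eta Heta. assert (H2 : 0 < eta / 2) by lra.
  pose proof (eventually_generates HN Hgen (a ++ b) H2) as E1.
  pose proof (eventually_generates HN Hgen (a ++ 0 :: b) H2) as E2.
  rewrite length_app in E1. apply (eventually_selected_delete (length a) 1) in E1.
  rewrite length_app in E2. cbn [length] in E2.
  rewrite <- Nat.add_assoc in E1. cbn [Nat.add] in E1.
  destruct (eventually_selected_exists (eventually_selected_and E1 E2)) as (t & Ht & HA & HB).
  destruct (split_length t _ _ Ht) as (t1 & t2 & -> & H1 & H3).
  destruct t2 as [|s t2]; [discriminate H3|].
  specialize (HA t1 [s] t2 eq_refl H1 eq_refl).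
  rewrite comb_app in HA, HB by exact H1. cbn [comb] in HB.
  rewrite vscal_0, vadd_0_l in HB.
  apply Rabs_le_inv in HA. apply Rabs_le_inv in HB. apply Rabs_le. lra.
Qed.

Context (N : list R -> R) (HN : is_seminorm N) (Hgen : generates k x L N).

Lemma eventually_subvector b a eta : subvector b a -> 0 < eta ->
  eventually_selected (length a)
    (fun t => vnorm (vadd (comb x t b) (vscal (lsum a - lsum b) x0)) <= N a + eta).
Proof.
  intros Hba Heta. assert (Heta2 : 0 < eta / 2) by lra.
  destruct (generates_far HL HN Hgen a Heta2) as [l Hl].
  pose proof (l1norm_nonneg a) as Hl1.
  (* Half of [eta] pays for the approximation by [N a], the other half for the total averaging
     error. *)
  assert (Heps : 0 < eta / 2 / (l1norm a + 1)) by (apply Rdiv_lt_0_compat; lra).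
  exists l, (eta / 2 / (l1norm a + 1)). split; [exact Heps|].
  intros Ts t Hm [HG1 HG2] Ht.
  assert (H := @comb_partial_average _ x x0 _ a b (Rlt_le _ _ Heps) Hba Ts HG1 Hm
    vzero (N a + eta / 2)).
  specialize (H (fun ss Hss => ltac:(
    rewrite vadd_0_l;
    pose proof (Hl ss (eq_trans (selection_length Hss) Hm) (HG2 ss Hss)) as H0;
    apply Rabs_le_inv in H0; lra)) t Ht).
  rewrite vadd_0_l in H. apply Rle_trans with (1 := H).
  assert (He : eta / 2 / (l1norm a + 1) * l1norm a <= eta / 2); [|lra].
  apply Rle_trans with (eta / 2 / (l1norm a + 1) * (l1norm a + 1)).
  - apply Rmult_le_compat_l; lra.
  - right. field. lra.
Qed.

(** The distance from [b] to a copy of itself further out: it is small when the combination depends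
    little on the chosen indices. *)
Definition osc (b : list R) : R := N (b ++ lscal (-1) b).

Lemma subvector_refl a : subvector a a.
Proof. induction a; constructor; auto. Qed.

Lemma subvector_zeros a : subvector (repeat 0 (length a)) a.
Proof. induction a; constructor; auto. Qed.

(** In [b ++ -b] the second half is averaged to [-(lsum b) x0]. The members [t2] only reserve the
    room for that half. *)
Lemma eventually_osc b eta : 0 < eta ->
  eventually_selected (length b + length b) (fun t => forall t1 t2, t = t1 ++ t2 ->
    length t1 = length b ->
    vnorm (vadd (comb x t1 b) (vopp (vscal (lsum b) x0))) <= osc b + eta).
Proof.
  intro Heta.
  assert (Hs : subvector (b ++ repeat 0 (length (lscal (-1) b))) (b ++ lscal (-1) b)).
  { apply Forall2_app; [apply subvector_refl|apply subvector_zeros]. }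
  destruct (eventually_subvector Hs Heta) as (l & e & He & HP).
  rewrite length_app, length_lscal in HP.
  exists l, e. split; [exact He|]. intros Ts t Hm HG Ht t1 t2 -> H1.
  specialize (HP Ts _ Hm HG Ht). rewrite comb_app, comb_zeros in HP by exact H1.
  rewrite !lsum_app, lsum_lscal, lsum_zeros in HP.
  replace (vadd (comb x t1 b) _) with (vadd (vadd (comb x t1 b) vzero)
    (vscal (lsum b + -1 * lsum b - (lsum b + 0)) x0)) by vec.
  exact HP.
Qed.

(** The extreme case of averaging, in which every coordinate is deleted. *)
Lemma spreading_norm_lower a : Rabs (lsum a) * vnorm x0 <= N a.
Proof.
  apply le_epsilon. intros eta Heta.
  destruct (eventually_selected_exists (eventually_subvector (subvector_zeros a) Heta))
    as (t & _ & H).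
  rewrite comb_zeros, lsum_zeros, vadd_0_l, Rminus_0_r, vnorm_scal in H. exact H.
Qed.

Lemma osc_subvector b a : subvector b a -> osc b <= 2 * N a.
Proof.
  intro Hba. pose proof (Forall2_length Hba) as Hlen.
  apply le_epsilon. intros eta Heta. assert (H3 : 0 < eta / 3) by lra.
  pose proof (eventually_subvector Hba H3) as E.
  pose proof (eventually_generates HN Hgen (b ++ lscal (-1) b) H3) as E'.
  rewrite length_app, length_lscal, <- Hlen in E'.
  destruct (eventually_selected_exists (eventually_selected_and E'
    (eventually_selected_and (eventually_selected_left (length a) E)
      (eventually_selected_right (length a) E)))) as (t & Ht & HA & HB & HC).
  destruct (split_length t _ _ Ht) as (t1 & t2 & -> & H1 & H2).
  specialize (HB _ _ eq_refl H1). specialize (HC _ _ eq_refl H1).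
  rewrite comb_app, comb_lscal in HA by lia. fold (osc b) in HA. apply Rabs_le_inv in HA.
  replace (vadd (comb x t1 b) _) with
    (vadd (vadd (comb x t1 b) (vscal (lsum a - lsum b) x0))
      (vscal (-1) (vadd (comb x t2 b) (vscal (lsum a - lsum b) x0)))) in HA by vec.
  pose proof (vnorm_triangle X (vadd (comb x t1 b) (vscal (lsum a - lsum b) x0))
      (vscal (-1) (vadd (comb x t2 b) (vscal (lsum a - lsum b) x0)))) as HT.
  rewrite (vnorm_scal X (-1)), (Rabs_left (-1)) in HT by lra. lra.
Qed.

(** Both combinations lie near the same multiple of [x0], within [osc N b] and [osc N c]
    respectively. *)
Lemma osc_pair b c : lsum b = lsum c -> N (b ++ lscal (-1) c) <= osc b + osc c.
Proof.
  intro Hbc. apply le_epsilon. intros eta Heta. assert (H3 : 0 < eta / 3) by lra.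
  pose proof (eventually_osc b H3) as E1. pose proof (eventually_osc c H3) as E2.
  pose proof (eventually_generates HN Hgen (b ++ lscal (-1) c) H3) as E.
  rewrite length_app, length_lscal in E.
  (* The common family has four blocks: one for [b], its spare block, one for [c], its spare block.
     The estimate for [b ++ -c] uses the first and third. *)
  apply (eventually_selected_delete (length b) (length b)) in E.
  apply (eventually_selected_left (length c)) in E.
  rewrite <- (Nat.add_assoc _ (length c)) in E.
  destruct (eventually_selected_exists (eventually_selected_and E
    (eventually_selected_and (eventually_selected_left (length c + length c) E1)
      (eventually_selected_right (length b + length b) E2)))) as (t & Ht & HA & HB & HC).
  destruct (split_length t _ _ Ht) as (t12 & t34 & -> & H12 & H34).
  destruct (split_length t12 _ _ H12) as (t1 & t2 & -> & H1 & H2).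
  destruct (split_length t34 _ _ H34) as (t3' & t4 & -> & H3' & H4).
  specialize (HB _ _ eq_refl H12 _ _ eq_refl H1).
  specialize (HC _ _ eq_refl H12 _ _ eq_refl H3').
  specialize (HA (t1 ++ t2 ++ t3') t4).
  rewrite <- !app_assoc in HA. rewrite !length_app in HA.
  specialize (HA eq_refl ltac:(lia) _ _ _ eq_refl H1 H2).
  rewrite comb_app, comb_lscal in HA by lia. apply Rabs_le_inv in HA.
  rewrite <- Hbc in HC.
  pose proof (vnorm_triangle X (vadd (comb x t1 b) (vopp (vscal (lsum b) x0)))
      (vscal (-1) (vadd (comb x t3' c) (vopp (vscal (lsum b) x0))))) as HT.
  replace (vadd (vadd (comb x t1 b) _) _) with (vadd (comb x t1 b) (vscal (-1) (comb x t3' c)))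
    in HT by vec.
  rewrite (vnorm_scal X (-1) (vadd _ _)), (Rabs_left (-1)) in HT by lra. lra.
Qed.

Lemma spreading_norm_upper b : N b <= Rabs (lsum b) * vnorm x0 + osc b.
Proof.
  apply le_epsilon. intros eta Heta. assert (H2 : 0 < eta / 2) by lra.
  pose proof (eventually_osc b H2) as E1.
  pose proof (eventually_generates HN Hgen b H2) as E.
  destruct (eventually_selected_exists (eventually_selected_and
    (eventually_selected_left (length b) E) E1)) as (t & Ht & HA & HB).
  destruct (split_length t _ _ Ht) as (t1 & t2 & -> & H1 & _).
  specialize (HA _ _ eq_refl H1). specialize (HB _ _ eq_refl H1).
  apply Rabs_le_inv in HA.
  pose proof (vnorm_le_add (comb x t1 b) (vscal (lsum b) x0)) as H.
  rewrite vnorm_scal in H. lra.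
Qed.

Context (N' : list R -> R) (HN' : is_seminorm N').
Context (Hgen' : generates k (fun s => vadd (x s) (vopp x0)) L N').

Lemma translate_norm_balanced a : lsum a = 0 -> N' a = N a.
Proof.
  intro Ha.
  assert (H : forall eta, 0 < eta -> Rabs (N' a - N a) <= eta).
  { intros eta Heta. assert (H2 : 0 < eta / 2) by lra.
    destruct (eventually_selected_exists (eventually_selected_and
      (eventually_generates HN Hgen a H2) (eventually_generates HN' Hgen' a H2)))
      as (t & Ht & HA & HB).
    rewrite comb_translate, Ha in HB by exact Ht.
    replace (vadd _ _) with (comb x t a) in HB by vec.
    apply Rabs_le_inv in HA. apply Rabs_le_inv in HB. apply Rabs_le. lra. }
  apply Rle_antisym; apply le_epsilon; intros eta Heta; specialize (H eta Heta);
    apply Rabs_le_inv in H; lra.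
Qed.

(** [N' a] approximates the norm of a combination minus [(lsum a) x0], and [x0] is no coefficient
    vector. A far combination [b] of sum 1 stands in for it, with error [osc b] times the mass. *)
Lemma translate_norm a b : lsum b = 1 ->
  Rabs (N (a ++ lscal (- lsum a) b) - N' a) <= Rabs (lsum a) * osc b.
Proof.
  intro Hb. apply le_epsilon. intros eta Heta.
  (* The oscillation error enters [Rabs (lsum a)] times and the two generation errors once each. *)
  pose (c := Rabs (lsum a) + 2).
  assert (Hc : 2 <= c) by (unfold c; pose proof (Rabs_pos (lsum a)); lra).
  assert (H3 : 0 < eta / c) by (apply Rdiv_lt_0_compat; lra).
  pose proof (eventually_osc b H3) as E1.
  apply (eventually_selected_right (length a)) in E1.
  pose proof (eventually_generates HN Hgen (a ++ lscal (- lsum a) b) H3) as E2.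
  rewrite length_app, length_lscal in E2.
  apply (eventually_selected_left (length b)) in E2. rewrite <- Nat.add_assoc in E2.
  pose proof (eventually_generates HN' Hgen' a H3) as E3.
  apply (eventually_selected_left (length b + length b)) in E3.
  destruct (eventually_selected_exists (eventually_selected_and E1
    (eventually_selected_and E2 E3))) as (t & Ht & HA & HB & HC).
  destruct (split_length t _ _ Ht) as (t1 & t23 & -> & H1 & H23).
  destruct (split_length t23 _ _ H23) as (t2 & t3 & -> & H2 & _).
  specialize (HA _ _ eq_refl H1 _ _ eq_refl H2).
  specialize (HB (t1 ++ t2) t3). rewrite <- app_assoc, length_app in HB.
  specialize (HB eq_refl ltac:(lia)). specialize (HC _ _ eq_refl H1).
  rewrite comb_translate in HC by exact H1.
  rewrite comb_app, comb_lscal in HB by exact H1.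
  rewrite Hb in HA.
  pose proof (vnorm_abs_sub (vadd (comb x t1 a) (vscal (- lsum a) (comb x t2 b)))
    (vadd (comb x t1 a) (vopp (vscal (lsum a) x0)))) as HT.
  replace (vadd (vadd (comb x t1 a) (vscal (- lsum a) (comb x t2 b))) _) with
    (vscal (- lsum a) (vadd (comb x t2 b) (vopp (vscal 1 x0)))) in HT by vec.
  rewrite vnorm_scal, Rabs_Ropp in HT.
  apply (Rmult_le_compat_l (Rabs (lsum a))) in HA; [|apply Rabs_pos].
  assert (He : Rabs (lsum a) * (eta / c) + 2 * (eta / c) = eta) by (unfold c; field; unfold c in Hc; lra).
  apply Rabs_le_inv in HB. apply Rabs_le_inv in HC. apply Rabs_le_inv in HT.
  apply Rabs_le. lra.
Qed.

End EventualSelections.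

(** * Seminorms on coefficient lists *)

Definition shift (K : nat) (a : list R) : list R := repeat 0 K ++ a.

Lemma nth_ladd i a b : nth i (ladd a b) 0 = nth i a 0 + nth i b 0.
Proof.
  revert i b; induction a as [|c a IH]; intros i [|d b]; cbn [ladd].
  - destruct i; simpl; ring.
  - destruct i; simpl; ring.
  - destruct i; simpl; ring.
  - destruct i as [|i]; simpl; [reflexivity|apply IH].
Qed.

Lemma nth_lscal i c a : nth i (lscal c a) 0 = c * nth i a 0.
Proof.
  revert i; induction a as [|d a IH]; intros [|i]; simpl; try ring. apply IH.
Qed.

Lemma nth_ldiff i a b : nth i (ldiff a b) 0 = nth i a 0 - nth i b 0.
Proof. unfold ldiff. rewrite nth_ladd, nth_lscal. ring. Qed.

Lemma nth_zeros i n : nth i (repeat 0 n) 0 = 0.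
Proof. revert i; induction n as [|n IH]; intros [|i]; simpl; auto. Qed.

Lemma nth_shift i K a : nth i (shift K a) 0 = if Nat.ltb i K then 0 else nth (i - K) a 0.
Proof.
  unfold shift. destruct (Nat.ltb_spec i K).
  - rewrite app_nth1 by (rewrite repeat_length; lia). apply nth_zeros.
  - rewrite app_nth2 by (rewrite repeat_length; lia). rewrite repeat_length. reflexivity.
Qed.

Lemma ladd_comm a b : ladd a b = ladd b a.
Proof.
  revert b; induction a as [|c a IH]; intros [|d b]; simpl; auto. rewrite IH. f_equal. ring.
Qed.

Lemma ladd_assoc a b c : ladd a (ladd b c) = ladd (ladd a b) c.
Proof.
  revert b c; induction a as [|r a IH]; intros [|s b] [|t c]; simpl; auto.
  rewrite IH. f_equal. ring.
Qed.

Lemma lscal_assoc r s a : lscal r (lscal s a) = lscal (r * s) a.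
Proof. induction a as [|c a IH]; simpl; [auto|]. rewrite IH. f_equal. ring. Qed.

Lemma lscal_1 a : lscal 1 a = a.
Proof. induction a as [|c a IH]; simpl; [auto|]. rewrite IH. f_equal. ring. Qed.

Lemma lscal_distr_v r a b : lscal r (ladd a b) = ladd (lscal r a) (lscal r b).
Proof.
  revert b; induction a as [|c a IH]; intros [|d b]; simpl; auto. rewrite IH. f_equal. ring.
Qed.

Lemma lscal_distr_s r s a : lscal (r + s) a = ladd (lscal r a) (lscal s a).
Proof. induction a as [|c a IH]; simpl; [auto|]. rewrite IH. f_equal. ring. Qed.

Definition list_premodule : PreModule :=
  mkPM ladd lscal ladd_assoc ladd_comm lscal_assoc lscal_1 lscal_distr_v lscal_distr_s.

Section Seminorm.
Context (N : list R -> R) (HN : is_seminorm N).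

Lemma seminorm_zeros_app a n : N (a ++ repeat 0 n) = N a.
Proof.
  induction n as [|n IH]; [rewrite app_nil_r; reflexivity|].
  rewrite <- IH. change (repeat 0 (S n)) with (0 :: repeat 0 n).
  rewrite repeat_cons, app_assoc. apply HN.
Qed.

(** Such lists differ only by trailing zeros, so both are padded to equal length. Vector identities
    under [N] are therefore checked coordinatewise. *)
Lemma seminorm_ext a b : (forall i, nth i a 0 = nth i b 0) -> N a = N b.
Proof.
  intro H. rewrite <- (seminorm_zeros_app a (length b)), <- (seminorm_zeros_app b (length a)).
  f_equal. apply nth_ext with 0 0.
  - rewrite !length_app, !repeat_length. lia.
  - intros i _. enough (forall c n, nth i (c ++ repeat 0 n) 0 = nth i c 0) as E
      by (rewrite !E; apply H).
    intros c n. destruct (Nat.lt_ge_cases i (length c)).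
    + apply app_nth1. exact H0.
    + rewrite app_nth2, nth_zeros, nth_overflow by lia. reflexivity.
Qed.

Lemma seminorm_zero a : (forall i, nth i a 0 = 0) -> N a = 0.
Proof.
  intro H. rewrite (@seminorm_ext a (lscal 0 a)).
  - destruct HN as (_ & Hs & _). rewrite Hs, Rabs_R0. ring.
  - intro i. rewrite nth_lscal, H. ring.
Qed.

Lemma seminorm_opp a : N (lscal (-1) a) = N a.
Proof. destruct HN as (_ & Hs & _). rewrite Hs, Rabs_left by lra. ring. Qed.

Lemma seminorm_nonneg a : 0 <= N a.
Proof.
  assert (H : N (ladd a (lscal (-1) a)) <= N a + N (lscal (-1) a)) by apply HN.
  rewrite seminorm_opp, seminorm_zero in H; [lra|].
  intro i. rewrite nth_ladd, nth_lscal. ring.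
Qed.

Lemma seminorm_ldiff_comm a b : N (ldiff a b) = N (ldiff b a).
Proof.
  rewrite <- seminorm_opp. apply seminorm_ext. intro i. rewrite nth_lscal, !nth_ldiff. ring.
Qed.

Lemma seminorm_le_ldiff a b : N a <= N b + N (ldiff a b).
Proof.
  rewrite (@seminorm_ext a (ladd b (ldiff a b))); [apply HN|].
  intro i. rewrite nth_ladd, nth_ldiff. ring.
Qed.

Lemma seminorm_ldiff_trans b a c : N (ldiff a c) <= N (ldiff a b) + N (ldiff b c).
Proof.
  rewrite (@seminorm_ext (ldiff a c) (ladd (ldiff a b) (ldiff b c))); [apply HN|].
  intro i. rewrite nth_ladd, !nth_ldiff. ring.
Qed.

Lemma seminorm_abs_sub a b : Rabs (N a - N b) <= N (ldiff a b).
Proof.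
  pose proof (seminorm_le_ldiff a b). pose proof (seminorm_le_ldiff b a) as H1.
  rewrite seminorm_ldiff_comm in H1. apply Rabs_le. lra.
Qed.

Lemma osc_lscal c b : osc N (lscal c b) = Rabs c * osc N b.
Proof.
  unfold osc. destruct HN as (_ & Hs & _). rewrite <- Hs. f_equal.
  unfold lscal. rewrite map_app, !map_map. f_equal. apply map_ext. intro. ring.
Qed.

(** A norming functional, obtained by separation with the demand [s * N a] at each point [s a] of a
    ray. *)
Lemma seminorm_support a : N a <> 0 ->
  exists f : list R -> R, c00_dual N f /\ (forall b, Rabs (f b) <= N b) /\ N a <= f a.
Proof.
  intro Ha.
  pose (K := fun (v : list_premodule) (t : R) => exists s, 0 <= s /\ v = lscal s a /\ t = s * N a).
  destruct HN as (H0 & Hs & Ht).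
  destruct (@cone_separation list_premodule N K) as (f & Hadd & Hscal & Hf & HfK).
  - split; cbn.
    + exact Ht.
    + intros t v Hpos. rewrite Hs, Rabs_pos_eq by exact Hpos. reflexivity.
    + intros v w. apply seminorm_ext. intro i. rewrite nth_ladd, nth_lscal. ring.
  - split; [|split].
    + exists a, 0. cbn. repeat split; lra.
    + intros v t w s (t1 & H1 & -> & ->) (t2 & H2 & -> & ->). exists (t1 + t2). cbn.
      split; [lra|]. split; [symmetry; apply lscal_distr_s|ring].
    + intros c v t Hc (t1 & H1 & -> & ->). exists (c * t1). cbn.
      split; [apply Rmult_le_pos; lra|]. split; [apply lscal_assoc|ring].
  - intros v t (s & Hpos & -> & ->). rewrite Hs, Rabs_pos_eq by exact Hpos. lra.
  - cbn in Hadd, Hscal.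
    assert (Habs : forall b, Rabs (f b) <= N b).
    { intro b. apply Rabs_le. split; [|apply Hf].
      specialize (Hf (lscal (-1) b)). rewrite Hscal, seminorm_opp in Hf. lra. }
    exists f. split; [|split; [exact Habs|]].
    + split; [|split; [exact Hadd|split; [exact Hscal|]]].
      * intro b. specialize (Habs (ldiff (b ++ [0]) b)). unfold ldiff in Habs.
        rewrite Hadd, Hscal, seminorm_zero in Habs; [apply Rabs_le_inv in Habs; lra|].
        intro i. rewrite nth_ladd, nth_lscal.
        destruct (Nat.lt_ge_cases i (length b)) as [H|H].
        -- rewrite app_nth1 by exact H. ring.
        -- rewrite app_nth2 by exact H. rewrite (nth_overflow b) by exact H.
           destruct (i - length b)%nat as [|[|j]]; simpl; ring.
      * exists 1. intro b. rewrite Rmult_1_l. apply Habs.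
    + apply HfK. exists 1. split; [lra|]. split; [symmetry; apply lscal_1|ring].
Qed.

Context (Hspread : forall a b, N (a ++ 0 :: b) = N (a ++ b)).

Lemma spreading_gap a b n : N (a ++ repeat 0 n ++ b) = N (a ++ b).
Proof. induction n as [|n IH]; [reflexivity|]. rewrite <- IH. apply Hspread. Qed.

Lemma spreading_shift K a : N (shift K a) = N a.
Proof. apply (spreading_gap []). Qed.

(** The shifted [c] starts after the end of [b], so the difference is [b], a gap of zeros and [-c];
    spreading closes the gap. *)
Lemma ldiff_shift b c K : (length b <= K)%nat ->
  N (ldiff b (shift K c)) = N (b ++ lscal (-1) c).
Proof.
  intro H. rewrite <- (spreading_gap b (lscal (-1) c) (K - length b)). apply seminorm_ext.
  intro i. rewrite nth_ldiff, nth_shift. destruct (Nat.ltb_spec i K).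
  - rewrite Rminus_0_r. destruct (Nat.lt_ge_cases i (length b)).
    + rewrite app_nth1 by lia. reflexivity.
    + rewrite app_nth2, app_nth1 by (rewrite ?repeat_length; lia).
      rewrite nth_zeros, nth_overflow by lia. reflexivity.
  - rewrite !app_nth2 by (rewrite ?repeat_length; lia).
    rewrite repeat_length, nth_lscal, (nth_overflow b) by lia.
    replace (i - length b - (K - length b))%nat with (i - K)%nat by lia. ring.
Qed.

Lemma osc_shift b K : (length b <= K)%nat -> N (ldiff b (shift K b)) = osc N b.
Proof. apply ldiff_shift. Qed.

Lemma spreading_l1_upper a : N a <= N [1] * l1norm a.
Proof.
  induction a as [|c a IH]; simpl.
  - rewrite seminorm_zero; [lra|]. intros [|i]; reflexivity.
  - rewrite (@seminorm_ext (c :: a) (ladd (lscal c [1]) (0 :: a))).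
    + destruct HN as (_ & Hs & Ht). pose proof (Ht (lscal c [1]) (0 :: a)) as H.
      pose proof (Hspread [] a) as H0. cbn [app] in H0. rewrite Hs, H0 in H. lra.
    + intros [|i]; rewrite nth_ladd, nth_lscal; simpl; [ring|].
      destruct i; ring.
Qed.

Lemma equiv_l1_of_lower c : 0 < c -> (forall a, c * l1norm a <= N a) -> equiv_l1 N.
Proof.
  intros Hc H. exists c, (N [1] + 1). split; [exact Hc|].
  pose proof (seminorm_nonneg [1]). split; [lra|]. intro a. split; [apply H|].
  pose proof (spreading_l1_upper a). pose proof (l1norm_nonneg a). lra.
Qed.

Lemma osc_le_twice a : osc N a <= 2 * N a.
Proof.
  rewrite <- (osc_shift a (Nat.le_refl _)).
  destruct HN as (_ & _ & Ht). unfold ldiff.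
  pose proof (Ht a (lscal (-1) (shift (length a) a))) as H.
  rewrite seminorm_opp, spreading_shift in H. lra.
Qed.

End Seminorm.

(** * Sign parts, and basic sequences equivalent to l1 *)

Lemma subvector_pos_part a : subvector (map (Rmax 0) a) a.
Proof.
  induction a as [|c a IH]; simpl; constructor; [|exact IH].
  unfold Rmax. destruct (Rle_dec 0 c); auto.
Qed.

Lemma subvector_neg_part a : subvector (map (Rmin 0) a) a.
Proof.
  induction a as [|c a IH]; simpl; constructor; [|exact IH].
  unfold Rmin. destruct (Rle_dec 0 c); auto.
Qed.

Lemma l1norm_parts a : l1norm a = lsum (map (Rmax 0) a) - lsum (map (Rmin 0) a).
Proof.
  induction a as [|c a IH]; simpl; [ring|]. rewrite IH.
  unfold Rmax, Rmin. destruct (Rle_dec 0 c).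
  - rewrite Rabs_pos_eq by lra. ring.
  - rewrite Rabs_left by lra. ring.
Qed.

Lemma l1norm_seminorm : is_seminorm l1norm.
Proof.
  split; [|split].
  - intro a. rewrite l1norm_app. simpl. rewrite Rabs_R0. ring.
  - apply l1norm_lscal.
  - intro a. induction a as [|c a IH]; intros [|d b]; simpl; try lra.
    specialize (IH b). pose proof (Rabs_triang c d). lra.
Qed.

Lemma nth_l1norm i a : Rabs (nth i a 0) <= l1norm a.
Proof.
  destruct (nth_in_or_default i a 0) as [H|H]; [apply in_l1norm, H|].
  rewrite H, Rabs_R0. apply l1norm_nonneg.
Qed.

Lemma nth_partial i a n : nth i (partial a n) 0 = if Nat.ltb i n then a i else 0.
Proof.
  unfold partial. destruct (Nat.ltb_spec i n).
  - rewrite nth_indep with (d' := a 0%nat) by (rewrite length_map, length_seq; lia).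
    rewrite map_nth, seq_nth by lia. reflexivity.
  - apply nth_overflow. rewrite length_map, length_seq. lia.
Qed.

Lemma l1norm_firstn_skipn n a : l1norm a = l1norm (firstn n a) + l1norm (skipn n a).
Proof. rewrite <- l1norm_app, firstn_skipn. reflexivity. Qed.

Lemma nth_firstn_default {A : Type} (d : A) i n l :
  nth i (firstn n l) d = if Nat.ltb i n then nth i l d else d.
Proof.
  revert i n; induction l as [|c l IH]; intros i n.
  - rewrite firstn_nil. destruct i, (Nat.ltb _ n); reflexivity.
  - destruct n as [|n]; [destruct i; reflexivity|]. destruct i as [|i]; [reflexivity|].
    simpl. rewrite IH. reflexivity.
Qed.

Lemma l1norm_partial_lim (a : nat -> R) (u : nat -> list R) :
  (forall i eps, 0 < eps -> exists j0, forall j, (j0 <= j)%nat -> Rabs (a i - nth i (u j) 0) < eps) ->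
  forall n eps, 0 < eps -> exists j0, forall j, (j0 <= j)%nat ->
    l1norm (ldiff (partial a n) (firstn n (u j))) < eps.
Proof.
  intros Hlim n. induction n as [|n IH]; intros eps Heps.
  - exists 0%nat. intros j _. cbn. exact Heps.
  - destruct (IH (eps / 2)) as [j1 H1]; [lra|].
    destruct (Hlim n (eps / 2)) as [j2 H2]; [lra|].
    exists (Nat.max j1 j2). intros j Hj. specialize (H1 j). specialize (H2 j).
    rewrite (seminorm_ext l1norm_seminorm _
      (ladd (ldiff (partial a n) (firstn n (u j))) (shift n [a n - nth n (u j) 0]))).
    + apply Rle_lt_trans with (1 := proj2 (proj2 l1norm_seminorm) _ _).
      unfold shift. rewrite l1norm_app. cbn [l1norm fold_right].
      rewrite (@seminorm_zero l1norm l1norm_seminorm (repeat 0 n)) by (intro; apply nth_zeros).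
      specialize (H1 ltac:(lia)). specialize (H2 ltac:(lia)). lra.
    + intro i. rewrite nth_ladd, !nth_ldiff, !nth_partial, !nth_firstn_default, nth_shift.
      destruct (Nat.ltb_spec i n), (Nat.ltb_spec i (S n)); try lia; try ring.
      * replace i with n by lia. rewrite Nat.sub_diag. simpl. ring.
      * destruct (i - n)%nat as [|[|m]] eqn:E; [lia| |]; simpl; ring.
Qed.

(** Completeness of l1 in coordinates: the expansion consists of the coordinatewise limits, and it
    is unique because the l1 norm dominates each coordinate. *)
Lemma equiv_l1_schauder_basic N : is_seminorm N -> equiv_l1 N -> schauder_basic N.
Proof.
  intros HN (c & C & Hc & HC & HcC) u Hu.
  assert (Hlow : forall a r, N a < c * r -> l1norm a < r).
  { intros a r H. apply Rmult_lt_reg_l with c; [exact Hc|].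
    apply Rle_lt_trans with (2 := H). apply HcC. }
  assert (Hu1 : forall eps, 0 < eps -> exists n0, forall i j, (n0 <= i)%nat -> (n0 <= j)%nat ->
    l1norm (ldiff (u i) (u j)) < eps).
  { intros eps Heps. destruct (Hu (c * eps)) as [n0 Hn0]; [apply Rmult_lt_0_compat; assumption|].
    exists n0. intros i j Hi Hj. apply Hlow, Hn0; assumption. }
  assert (Hcv : forall i, exists r, Un_cv (fun j => nth i (u j) 0) r).
  { intro i. destruct (R_complete (fun j => nth i (u j) 0)) as [r Hr]; [|exists r; exact Hr].
    intros eps Heps. destruct (Hu1 eps Heps) as [n0 Hn0]. exists n0. intros p q Hp Hq.
    unfold Rdist. rewrite <- nth_ldiff. apply Rle_lt_trans with (1 := nth_l1norm _ _).
    apply Hn0; assumption. }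
  pose (a := fun i => proj1_sig (constructive_indefinite_description _ (Hcv i))).
  assert (Ha : forall i eps, 0 < eps -> exists j0, forall j, (j0 <= j)%nat ->
    Rabs (a i - nth i (u j) 0) < eps).
  { intros i eps Heps. unfold a.
    destruct (constructive_indefinite_description _ (Hcv i)) as [r Hr]. cbn.
    destruct (Hr eps Heps) as [j0 Hj0]. exists j0. intros j Hj.
    rewrite Rabs_minus_sym. apply Hj0. exact Hj. }
  exists a. split.
  - intros eps Heps.
    assert (He : 0 < eps / (2 * C)) by (apply Rdiv_lt_0_compat; lra).
    (* Beyond its length [u j1] vanishes, so closeness to [u j1] makes the tails of all later [u j]
       uniformly small. *)
    destruct (Hu1 _ He) as [j1 Hj1]. exists (length (u j1)). intros n Hn.
    destruct (l1norm_partial_lim a u Ha n He) as [j2 Hj2].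
    exists (Nat.max j1 j2). intros j Hj.
    specialize (Hj1 j j1 ltac:(lia) ltac:(lia)). specialize (Hj2 j ltac:(lia)).
    assert (Htail : l1norm (skipn n (u j)) < eps / (2 * C)).
    { apply Rle_lt_trans with (2 := Hj1). rewrite (l1norm_firstn_skipn n (ldiff _ _)).
      replace (l1norm (skipn n (u j))) with (l1norm (skipn n (ldiff (u j) (u j1)))).
      - pose proof (l1norm_nonneg (firstn n (ldiff (u j) (u j1)))). lra.
      - apply (seminorm_ext l1norm_seminorm). intro i. rewrite !nth_skipn, nth_ldiff.
        rewrite (nth_overflow (u j1)) by lia. ring. }
    assert (Hl : l1norm (ldiff (partial a n) (u j)) < eps / C).
    { replace (eps / C) with (eps / (2 * C) + eps / (2 * C)) by (field; lra).
      rewrite (seminorm_ext l1norm_seminorm _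
        (ldiff (ldiff (partial a n) (firstn n (u j))) (shift n (skipn n (u j))))).
      - apply Rle_lt_trans with (1 := proj2 (proj2 l1norm_seminorm) _ _).
        rewrite (seminorm_opp l1norm_seminorm). unfold shift at 1. rewrite l1norm_app.
        rewrite (@seminorm_zero l1norm l1norm_seminorm (repeat 0 n)) by (intro; apply nth_zeros).
        lra.
      - intro i. rewrite !nth_ldiff, nth_partial, nth_firstn_default, nth_shift.
        destruct (Nat.ltb_spec i n); [ring|]. rewrite nth_skipn.
        replace (n + (i - n))%nat with i by lia. ring. }
    apply Rle_lt_trans with (C * l1norm (ldiff (partial a n) (u j))); [apply HcC|].
    apply (Rmult_lt_compat_l C) in Hl; [|exact HC].
    replace (C * (eps / C)) with eps in Hl by (field; lra). exact Hl.
  - intros b Hb i. apply cond_eq. intros eps Heps.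
    destruct (Ha i (eps / 2)) as [j1 Hj1]; [lra|].
    destruct (Hb (c * (eps / 2))) as [n0 Hn0]; [apply Rmult_lt_0_compat; lra|].
    destruct (Hn0 (Nat.max n0 (S i))) as [j2 Hj2]; [lia|].
    specialize (Hj1 (Nat.max j1 j2) ltac:(lia)). specialize (Hj2 (Nat.max j1 j2) ltac:(lia)).
    apply Hlow in Hj2. pose proof (nth_l1norm i (ldiff (partial b (Nat.max n0 (S i))) (u (Nat.max j1 j2)))) as H.
    rewrite nth_ldiff, nth_partial in H.
    destruct (Nat.ltb_spec i (Nat.max n0 (S i))); [|lia].
    apply Rabs_def2 in Hj1. apply Rabs_le_inv in H. apply Rabs_def1; lra.
Qed.

(** * Spreading seminorms that are not equivalent to l1 *)

Section NotL1.
Context (N : list R -> R) (HN : is_seminorm N).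
Context (Hspread : forall a b, N (a ++ 0 :: b) = N (a ++ b)).

Lemma small_osc : (forall a b, subvector b a -> osc N b <= 2 * N a) -> ~ equiv_l1 N ->
  forall eps, 0 < eps -> exists b, lsum b = 1 /\ osc N b <= eps.
Proof.
  intros Hsub Hl1 eps Heps.
  (* The factor 4 combines the 2 of [Hsub] with the half of [l1norm a] retained by the sum of a sign
     part. *)
  assert (Ha : exists a, N a < eps / 4 * l1norm a).
  { apply NNPP. intro H. apply Hl1. apply (equiv_l1_of_lower HN Hspread) with (eps / 4); [lra|].
    intro a. apply Rnot_lt_le. intro Ha. apply H. exists a. exact Ha. }
  destruct Ha as [a Ha].
  assert (Hpos : 0 < l1norm a).
  { pose proof (seminorm_nonneg HN a). destruct (l1norm_nonneg a) as [H0|H0]; [exact H0|].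
    rewrite <- H0, Rmult_0_r in Ha. lra. }
  assert (Hd : exists d, subvector d a /\ l1norm a / 2 <= Rabs (lsum d)).
  { pose proof (l1norm_parts a) as Hp.
    destruct (Rle_lt_dec (l1norm a / 2) (lsum (map (Rmax 0) a))) as [H|H].
    - exists (map (Rmax 0) a). split; [apply subvector_pos_part|].
      pose proof (Rle_abs (lsum (map (Rmax 0) a))). lra.
    - exists (map (Rmin 0) a). split; [apply subvector_neg_part|].
      rewrite Rabs_left; lra. }
  destruct Hd as (d & Hda & Hd).
  assert (Hd0 : lsum d <> 0). { intro H. rewrite H, Rabs_R0 in Hd. lra. }
  exists (lscal (/ lsum d) d). split.
  - rewrite lsum_lscal. apply Rinv_l, Hd0.
  - rewrite (osc_lscal HN), Rabs_inv. specialize (Hsub _ _ Hda).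
    apply Rmult_le_reg_l with (Rabs (lsum d)); [lra|].
    rewrite <- Rmult_assoc, Rinv_r, Rmult_1_l by lra.
    apply (Rmult_le_compat_r eps) in Hd; [|lra]. lra.
Qed.

Context (Hpair : forall b c, lsum b = lsum c -> N (b ++ lscal (-1) c) <= osc N b + osc N c).

(** A copy of [c] beyond both supports is the intermediate point: [Hpair] compares it with [b], and
    its distance from [c] is [osc N c]. *)
Lemma osc_ldiff b c : lsum b = lsum c -> N (ldiff b c) <= osc N b + 2 * osc N c.
Proof.
  intro H. pose (K := Nat.max (length b) (length c)).
  pose proof (seminorm_ldiff_trans HN (shift K c) b c) as HT.
  rewrite (ldiff_shift HN Hspread) in HT by (unfold K; lia).
  rewrite (seminorm_ldiff_comm HN (shift K c) c), (osc_shift HN Hspread) in HT by (unfold K; lia).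
  specialize (Hpair b c H). lra.
Qed.

Lemma osc_shift1 b : N (ldiff (shift 1 b) b) <= 2 * osc N b.
Proof.
  (* With this [K], the difference of [shift 1 b] and [shift K b] is itself a shift of
     [b - shift (length b) b], so both distances to [shift K b] equal [osc N b]. *)
  pose (K := S (length b)).
  pose proof (seminorm_ldiff_trans HN (shift K b) (shift 1 b) b) as HT.
  rewrite (seminorm_ldiff_comm HN (shift K b) b), (osc_shift HN Hspread) in HT by (unfold K; lia).
  rewrite (@seminorm_ext N HN (ldiff (shift 1 b) (shift K b))
    (shift 1 (ldiff b (shift (length b) b)))) in HT.
  - rewrite (spreading_shift _ Hspread), (osc_shift HN Hspread) in HT by lia. lra.
  - intro i. unfold K. rewrite nth_ldiff, !nth_shift, nth_ldiff, nth_shift.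
    destruct (Nat.ltb_spec i 1), (Nat.ltb_spec i (S (length b))),
      (Nat.ltb_spec (i - 1) (length b)); try lia; try ring.
    replace (i - S (length b))%nat with (i - 1 - length b)%nat by lia. ring.
Qed.

(* The limit [e] of the vectors of small oscillation is invariant under the shift,
   so the coefficients of an expansion of [e] would all vanish. *)
Lemma small_osc_not_schauder (r : R) : 0 < r -> (forall b, lsum b = 1 -> r <= N b) ->
  (forall eps, 0 < eps -> exists b, lsum b = 1 /\ osc N b <= eps) -> ~ schauder_basic N.
Proof.
  intros Hr Hlow Hex Hsch.
  assert (Hexj : forall j, exists b, lsum b = 1 /\ osc N b <= / INR (S j)).
  { intro j. apply Hex. apply Rinv_0_lt_compat, lt_0_INR. lia. }
  pose (u := fun j => proj1_sig (constructive_indefinite_description _ (Hexj j))).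
  assert (Hu : forall j, lsum (u j) = 1 /\ osc N (u j) <= / INR (S j)).
  { intro j. unfold u. apply proj2_sig. }
  assert (Hsmall : forall eps, 0 < eps -> exists n0, forall j, (n0 <= j)%nat -> osc N (u j) < eps).
  { intros eps Heps. destruct (archimed_cor1 eps Heps) as (n & Hn & Hn0). exists n.
    intros j Hj. destruct (Hu j) as [_ H]. apply Rle_lt_trans with (1 := H).
    apply Rle_lt_trans with (2 := Hn). apply Rinv_le_contravar.
    - apply lt_0_INR, Hn0.
    - apply le_INR. lia. }
  assert (Hcauchy : N_cauchy N u).
  { intros eps Heps. destruct (Hsmall (eps / 3)) as [n0 Hn0]; [lra|]. exists n0.
    intros i j Hi Hj. pose proof (Hn0 i Hi). pose proof (Hn0 j Hj).
    destruct (Hu i) as [Hi1 _]. destruct (Hu j) as [Hj1 _].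
    pose proof (@osc_ldiff (u i) (u j)). rewrite Hi1, Hj1 in *. lra. }
  destruct (Hsch u Hcauchy) as (a & Ha & Huniq).
  (* This also expands the limit of [u]; uniqueness then gives [a 0 = 0] and [a (S n) = a n]. *)
  pose (b := fun i => match i with O => 0 | S i' => a i' end).
  assert (Hb : expands N b u).
  { intros eps Heps. destruct (Ha (eps / 2)) as [n0 Hn0]; [lra|].
    destruct (Hsmall (eps / 4)) as [j1 Hj1]; [lra|].
    exists (S n0). intros [|n] Hn; [lia|]. destruct (Hn0 n) as [j0 Hj0]; [lia|].
    exists (Nat.max j0 j1). intros j Hj. specialize (Hj0 j ltac:(lia)). specialize (Hj1 j ltac:(lia)).
    pose proof (seminorm_ldiff_trans HN (shift 1 (u j)) (partial b (S n)) (u j)) as HT.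
    pose proof (osc_shift1 (u j)).
    rewrite (@seminorm_ext N HN (ldiff (partial b (S n)) (shift 1 (u j)))
      (shift 1 (ldiff (partial a n) (u j)))) in HT.
    - rewrite (spreading_shift _ Hspread) in HT. lra.
    - intros [|i]; rewrite nth_ldiff, nth_partial, !nth_shift; [simpl; ring|].
      rewrite nth_ldiff, nth_partial. simpl. rewrite Nat.sub_0_r. reflexivity. }
  assert (Ha0 : forall n, a n = 0).
  { intro n. induction n as [|n IH]; rewrite (Huniq b Hb); [reflexivity|exact IH]. }
  destruct (Ha r Hr) as [n0 Hn0]. destruct (Hn0 n0 (Nat.le_refl _)) as [j0 Hj0].
  specialize (Hj0 j0 (Nat.le_refl _)). destruct (Hu j0) as [Hs _]. specialize (Hlow _ Hs).
  rewrite (seminorm_ldiff_comm HN) in Hj0.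
  rewrite (@seminorm_ext N HN (ldiff (u j0) (partial a n0)) (u j0)) in Hj0; [lra|].
  intro i. rewrite nth_ldiff, nth_partial, Ha0. destruct (Nat.ltb i n0); ring.
Qed.

(** Far out, [f] takes nearly the value [f (u j)] at each unit vector, so a far copy of [b] looks to
    [f] like [lsum b] times the weak limit. *)
Lemma weak_limit_shift u f : (forall b, Rabs (f b) <= N b) -> c00_dual N f ->
  forall eps n0, (forall n, (n0 <= n)%nat -> exists j0, forall j, (j0 <= j)%nat ->
    Rabs (f (unit_vec n) - f (u j)) < eps) ->
  forall b K, (n0 <= K)%nat -> exists j0, forall j, (j0 <= j)%nat ->
    Rabs (f (shift K b) - lsum b * f (u j)) <= eps * l1norm b.
Proof.
  intros Hf (_ & Hadd & Hscal & _) eps n0 Hw b.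
  assert (Hext : forall a c, (forall i, nth i a 0 = nth i c 0) -> f a = f c).
  { intros a c Hac. specialize (Hf (ldiff a c)). unfold ldiff in Hf.
    rewrite Hadd, Hscal, (seminorm_zero HN) in Hf; [apply Rabs_le_inv in Hf; lra|].
    intro i. rewrite nth_ladd, nth_lscal, Hac. ring. }
  induction b as [|c b IH]; intros K HK; simpl.
  - exists 0%nat. intros j _. specialize (Hf (shift K [])).
    rewrite (seminorm_zero HN) in Hf.
    + apply Rabs_le_inv in Hf. apply Rabs_le. lra.
    + intro i. rewrite nth_shift. destruct (Nat.ltb i K); [reflexivity|].
      destruct (i - K)%nat; reflexivity.
  - destruct (IH (S K)) as [j1 H1]; [lia|]. destruct (Hw K HK) as [j2 H2].
    exists (Nat.max j1 j2). intros j Hj. specialize (H1 j ltac:(lia)). specialize (H2 j ltac:(lia)).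
    rewrite (Hext (shift K (c :: b)) (ladd (lscal c (unit_vec K)) (shift (S K) b))).
    + rewrite Hadd, Hscal.
      replace (c * f (unit_vec K) + f (shift (S K) b) - (c + lsum b) * f (u j)) with
        (c * (f (unit_vec K) - f (u j)) + (f (shift (S K) b) - lsum b * f (u j))) by ring.
      eapply Rle_trans; [apply Rabs_triang|]. rewrite Rabs_mult.
      apply Rlt_le, (Rmult_le_compat_l (Rabs c)) in H2; [|apply Rabs_pos]. lra.
    + intro i. change (unit_vec K) with (shift K [1]).
      rewrite nth_ladd, nth_lscal, !nth_shift.
      destruct (Nat.ltb_spec i K), (Nat.ltb_spec i (S K)); try lia; try ring.
      * replace (i - K)%nat with 0%nat by lia. simpl. ring.
      * replace (i - K)%nat with (S (i - S K)) by lia. simpl.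
        destruct (i - S K)%nat; ring.
Qed.

(** For a functional [f] norming [u j - b], three steps of size [eps] lead from [f (u j)] to [f b]:
    to a later [u j'] by the Cauchy property, to a far copy of [b] by weak convergence, and back to
    [b] by [osc]. The index [j0] comes from the Cauchy property alone, so it depends neither on [f]
    nor on [b]. *)
Lemma weak_limit_close u : weak_limit_in_E N u -> forall eps, 0 < eps ->
  exists j0, forall j, (j0 <= j)%nat -> forall b, lsum b = 1 -> osc N b <= eps ->
    N (ldiff (u j) b) <= 3 * eps.
Proof.
  intros [Hc Hw] eps Heps. destruct (Hc eps Heps) as [j0 Hj0]. exists j0.
  intros j Hj b Hb Hosc. apply Rnot_lt_le. intro Hfar.
  destruct (@seminorm_support N HN (ldiff (u j) b)) as (f & Hfd & Hfle & Hf); [lra|].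
  pose proof (l1norm_nonneg b) as Hl1.
  assert (He : 0 < eps / (l1norm b + 1)) by (apply Rdiv_lt_0_compat; lra).
  destruct (Hw f Hfd _ He) as [n0 Hn0].
  pose (K := Nat.max n0 (length b)).
  destruct (@weak_limit_shift u f Hfle Hfd _ n0 Hn0 b K) as [j1 Hj1]; [unfold K; lia|].
  specialize (Hj1 (Nat.max j0 j1) ltac:(lia)). specialize (Hj0 j (Nat.max j0 j1) Hj ltac:(lia)).
  assert (Heb : eps / (l1norm b + 1) * l1norm b <= eps).
  { apply Rle_trans with (eps / (l1norm b + 1) * (l1norm b + 1)).
    - apply Rmult_le_compat_l; lra.
    - right. field. lra. }
  pose proof (osc_shift HN Hspread b (K := K) ltac:(unfold K; lia)) as Hs.
  pose proof (Hfle (ldiff b (shift K b))) as H1.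
  pose proof (Hfle (ldiff (u j) (u (Nat.max j0 j1)))) as H2.
  destruct Hfd as (_ & Hadd & Hscal & _). unfold ldiff in H1, H2, Hf at 2.
  rewrite Hadd, Hscal in H1, H2, Hf. rewrite Hb in Hj1.
  apply Rabs_le_inv in H1. apply Rabs_le_inv in H2. apply Rabs_le_inv in Hj1.
  fold (ldiff b (shift K b)) in H1. fold (ldiff (u j) (u (Nat.max j0 j1))) in H2. lra.
Qed.

End NotL1.

(** * The dichotomy *)

Theorem mainTheorem7 (X : NormedSpace) (HX : Banach X) (k : nat) (Hk : (1 <= k)%nat)
  (x : list nat -> X) (x0 : X) (Hsub : subordinated_weak k x x0)
  (M : nat -> nat) (HM : strictly_increasing M)
  (N : list R -> R) (HN : is_seminorm N) (Hgen : generates k x M N)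
  (Hnt : ~ trivial_seq N) (Hx0 : x0 <> vzero) :
  let x' := fun s => vadd (x s) (vopp x0) in
  (alternative_i k x' M N /\ ~ alternative_ii k x' M N x0) \/
  (~ alternative_i k x' M N /\ alternative_ii k x' M N x0).
Proof.
  intro x'.
  (* Equivalence of [N] with l1 decides: it makes [(e_n)] basic and so excludes (ii), while its
     failure contradicts (i) directly. *)
  destruct (classic (equiv_l1 N)) as [Hl1|Hl1].
  - left. split.
    + split; [exact Hl1|]. intros N' (L & HLM & HN' & Hgen').
      pose proof (generates_subset HM HLM Hgen) as HgenL. destruct HLM as [HL _].
      pose proof (spreading_insert0 Hk Hsub HL HN' Hgen') as Hspread'.
      destruct Hl1 as (c & C & Hc & HC & HcC).
      apply (equiv_l1_of_lower HN' Hspread') with c; [exact Hc|]. intro a.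
      (* [a ++ -a] has sum zero and twice the l1 norm of [a], so the lower constant [c] passes from
         [N] to [N'] unchanged. *)
      pose proof (osc_le_twice HN' Hspread' a) as H1. unfold osc in H1.
      rewrite (translate_norm_balanced Hk Hsub HL HN HgenL HN' Hgen') in H1
        by (rewrite lsum_app, lsum_lscal; ring).
      destruct (HcC (a ++ lscal (-1) a)) as [H2 _].
      rewrite l1norm_app, l1norm_lscal, Rabs_left in H2 by lra. lra.
    + intros [[_ Hns] _]. apply Hns, equiv_l1_schauder_basic; assumption.
  - right. split; [intros [H _]; auto|].
    pose proof (spreading_insert0 Hk Hsub HM HN Hgen) as Hspread.
    pose proof (osc_pair Hk Hsub HM HN Hgen) as Hpair.
    pose proof (vnorm_pos Hx0) as Hpos.
    assert (Hlow : forall b, lsum b = 1 -> vnorm x0 <= N b).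
    { intros b Hb. pose proof (spreading_norm_lower Hk Hsub HM HN Hgen b) as H.
      rewrite Hb, Rabs_R1 in H. lra. }
    assert (Hsmall := small_osc HN Hspread
      (fun a b H => osc_subvector Hk Hsub HM HN Hgen H) Hl1).
    split; [split; [exact Hnt|]|].
    + apply (small_osc_not_schauder HN Hspread Hpair Hpos Hlow Hsmall).
    + intros u Hu. split.
      * intros N' (L & HLM & HN' & Hgen') a.
        pose proof (generates_subset HM HLM Hgen) as HgenL. destruct HLM as [HL _].
        intros eps Heps.
        pose (c := Rabs (lsum a)). assert (Hc : 0 <= c) by apply Rabs_pos.
        (* The mass [c] multiplies an error [4 * e] from replacing [u j] by a far copy of [b] and an
           error [e] from [translate_norm]; the added 1 covers [c = 0]. *)
        pose (e := eps / (5 * c + 1)).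
        assert (He : 0 < e) by (apply Rdiv_lt_0_compat; lra).
        assert (Hce : 5 * c * e < eps).
        { replace eps with (5 * c * e + e) at 1; [lra|]. unfold e. field. lra. }
        destruct (weak_limit_close HN Hspread Hu He) as [j0 Hj0].
        destruct (Hsmall e He) as (b & Hb & Hosc).
        exists j0. intros j Hj. specialize (Hj0 j Hj b Hb Hosc). unfold Rdist.
        (* The copy of [b] must clear [a] for [ldiff_shift] and [b] itself for [osc_shift]. *)
        pose (K := Nat.max (length a) (length b)).
        pose proof (translate_norm Hk Hsub HL HN HgenL HN' Hgen' a b Hb) as H1.
        pose proof (seminorm_abs_sub HN (ldiff a (lscal (lsum a) (u j)))
          (ldiff a (shift K (lscal (lsum a) b)))) as H2.
        rewrite (ldiff_shift HN Hspread a) in H2 by (unfold K; lia).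
        rewrite (lscal_assoc (-1)) in H2. replace (-1 * lsum a) with (- lsum a) in H2 by ring.
        assert (H3 : N (ldiff (u j) (shift K b)) <= 4 * e).
        { pose proof (seminorm_ldiff_trans HN b (u j) (shift K b)) as HT.
          rewrite (osc_shift HN Hspread b) in HT by (unfold K; lia). lra. }
        rewrite (@seminorm_ext N HN (ldiff (ldiff a (lscal (lsum a) (u j)))
          (ldiff a (shift K (lscal (lsum a) b))))
          (lscal (- lsum a) (ldiff (u j) (shift K b)))) in H2.
        -- destruct HN as (_ & Hs & _). rewrite Hs, Rabs_Ropp in H2. fold c in H1, H2.
           apply (Rmult_le_compat_l c) in H3; [|exact Hc].
           apply (Rmult_le_compat_l c) in Hosc; [|exact Hc].
           apply Rabs_le_inv in H1. apply Rabs_le_inv in H2. apply Rabs_def1; lra.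
        -- intro i. rewrite nth_lscal, !nth_ldiff, !nth_shift, !nth_lscal.
           destruct (Nat.ltb i K); ring.
      (* [N (u j)] is within three of these units of [N b], and [N b] within one of [vnorm x0]; the
         fifth makes the inequality strict. *)
      * intros eps Heps. assert (He : 0 < eps / 5) by lra.
        destruct (weak_limit_close HN Hspread Hu He) as [j0 Hj0].
        destruct (Hsmall _ He) as (b & Hb & Hosc).
        exists j0. intros j Hj. specialize (Hj0 j Hj b Hb Hosc). unfold Rdist.
        pose proof (seminorm_abs_sub HN (u j) b) as H1. specialize (Hlow b Hb).
        pose proof (spreading_norm_upper Hk Hsub HM HN Hgen b) as H2.
        rewrite Hb, Rabs_R1 in H2. apply Rabs_le_inv in H1. apply Rabs_def1; lra.
Qed.
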